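(* Let $1<p<q$. Let $X$ be an infinite dimensional Banach space with the almost $p$-co-Banach-Saks property, and let $Y$ be a reflexive asymptotically $q$-uniformly smooth Banach space. Then $\alpha_Y(X)\le p/q$. In particular, $X$ does not coarse Lipschitz embed into $Y$.
   Context: $X$ has the almost $p$-co-Banach-Saks property if for every semi-normalized weakly null sequence $(x_n)$ in $X$ there exist a subsequence $(x_{n_j})$ and numbers $\theta_j\in[1,\infty)$ with $\lim_{j\to\infty}j^\alpha\theta_j^{-1}=\infty$ for all $\alpha>0$ and $\|x_{n_{j_1}}+\dots+x_{n_{j_k}}\|\ge k^{1/p}\theta_k^{-1}$ for all $k$ and all $k\le j_1<\dots<j_k$. $Y$ is asymptotically $q$-uniformly smooth if $\overline\rho_Y(t)\le Ct^q$ on $[0,1]$, with $\overline{\rho}_Y(t)=\sup_{y\in\partial B_Y}\inf_{\dim(Y/E)<\infty}\sup_{h\in\partial B_E}\|y+th\|-1$. The compression exponent $\alpha_Y(X)$ is the supremum of $\alpha>0$ for which there exist a coarse embedding $f:X\to Y$ and $L>0$ with $\|f(x)-f(y)\|\ge L^{-1}\|x-y\|^\alpha-L$ for all $x,y$ ($0$ if none); $f$ is a coarse embedding if $\omega_f(t)=\sup\{\|f(x)-f(y)\|:\|x-y\|\le t\}<\infty$ for all $t$ and $\rho_f(t)=\inf\{\|f(x)-f(y)\|:\|x-y\|\ge t\}\to\infty$; a coarse Lipschitz embedding if $\omega_f(t)\le Lt+L$ and $\rho_f(t)\ge L^{-1}t-L$ for some $L>0$. *)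

(* Defs.v *)
From Stdlib Require Import Reals Lra.
Open Scope R_scope.

Record NormedSpace := {
  carrier :> Type;
  vzero : carrier;
  vadd : carrier -> carrier -> carrier;
  vopp : carrier -> carrier;
  vscal : R -> carrier -> carrier;
  vnorm : carrier -> R;
  vadd_assoc : forall x y z, vadd x (vadd y z) = vadd (vadd x y) z;
  vadd_comm : forall x y, vadd x y = vadd y x;
  vadd_zero : forall x, vadd x vzero = x;
  vadd_opp : forall x, vadd x (vopp x) = vzero;
  vscal_one : forall x, vscal 1 x = x;
  vscal_assoc : forall a b x, vscal a (vscal b x) = vscal (a * b) x;
  vscal_addr : forall a x y, vscal a (vadd x y) = vadd (vscal a x) (vscal a y);
  vscal_addl : forall a b x, vscal (a + b) x = vadd (vscal a x) (vscal b x);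
  vnorm_eq0 : forall x, vnorm x = 0 -> x = vzero;
  vnorm_scal : forall a x, vnorm (vscal a x) = Rabs a * vnorm x;
  vnorm_triangle : forall x y, vnorm (vadd x y) <= vnorm x + vnorm y
}.

Arguments vzero {_}.
Arguments vadd {_}.
Arguments vopp {_}.
Arguments vscal {_}.
Arguments vnorm {_}.

Definition vsub {V : NormedSpace} (x y : V) : V := vadd x (vopp y).
Definition dist {V : NormedSpace} (x y : V) : R := vnorm (vsub x y).

Fixpoint vsum {V : NormedSpace} (g : nat -> V) (k : nat) : V :=
  match k with
  | O => vzero
  | S k' => vadd (vsum g k') (g k')
  end.

Definition complete (V : NormedSpace) : Prop :=
  forall u : nat -> V,
    (forall eps, 0 < eps -> exists N, forall m n, (N <= m)%nat -> (N <= n)%nat ->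
        dist (u m) (u n) < eps) ->
    exists l : V, forall eps, 0 < eps -> exists N, forall n, (N <= n)%nat ->
        dist (u n) l < eps.

Definition infinite_dimensional (V : NormedSpace) : Prop :=
  forall (n : nat) (e : nat -> V), exists x : V,
    ~ exists c : nat -> R, x = vsum (fun i => vscal (c i) (e i)) n.

Definition linear_functional {V : NormedSpace} (f : V -> R) : Prop :=
  (forall x y, f (vadd x y) = f x + f y) /\ (forall a x, f (vscal a x) = a * f x).

Definition bound_by {V : NormedSpace} (f : V -> R) (M : R) : Prop :=
  0 <= M /\ forall x, Rabs (f x) <= M * vnorm x.

Definition bounded_linear {V : NormedSpace} (f : V -> R) : Prop :=
  linear_functional f /\ exists M, bound_by f M.

Definition weakly_null {V : NormedSpace} (x : nat -> V) : Prop :=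
  forall f : V -> R, bounded_linear f -> Un_cv (fun n => f (x n)) 0.

(** Reflexivity: every bounded linear functional Phi on V* (with the
    operator norm ||f|| = inf { M | bound_by f M }) is evaluation at
    some point of V.  Phi is only relevant on elements of V*. *)
Definition dual_linear {V : NormedSpace} (Phi : (V -> R) -> R) : Prop :=
  forall (f g h : V -> R) (a b : R),
    bounded_linear f -> bounded_linear g ->
    (forall x, h x = a * f x + b * g x) ->
    Phi h = a * Phi f + b * Phi g.

Definition dual_bounded {V : NormedSpace} (Phi : (V -> R) -> R) : Prop :=
  exists C, 0 <= C /\
    forall (f : V -> R) (M : R), bounded_linear f -> bound_by f M ->
      Rabs (Phi f) <= C * M.

Definition reflexive (V : NormedSpace) : Prop :=
  forall Phi : (V -> R) -> R, dual_linear Phi -> dual_bounded Phi ->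
    exists x : V, forall f, bounded_linear f -> Phi f = f x.

(** * Powers with the convention 0^a = 0 (for a > 0) *)
Definition rpow (x a : R) : R := if Rle_dec x 0 then 0 else Rpower x a.

(** * Almost p-co-Banach-Saks property (indices j, k start at 1) *)
Definition semi_normalized {V : NormedSpace} (x : nat -> V) : Prop :=
  exists a b, 0 < a /\ a <= b /\ forall n, a <= vnorm (x n) <= b.

Definition strictly_increasing (phi : nat -> nat) : Prop :=
  forall n, (phi n < phi (S n))%nat.

Definition almost_p_co_Banach_Saks (p : R) (X : NormedSpace) : Prop :=
  forall x : nat -> X, semi_normalized x -> weakly_null x ->
    exists (phi : nat -> nat) (theta : nat -> R),
      strictly_increasing phi /\
      (forall j, 1 <= theta j) /\
      (forall alpha, 0 < alpha -> cv_infty (fun j => rpow (INR j) alpha / theta j)) /\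
      (forall (k : nat) (s : nat -> nat),
          (1 <= k)%nat ->
          (forall i, (S i < k)%nat -> (s i < s (S i))%nat) ->
          (k <= s O)%nat ->
          rpow (INR k) (1 / p) / theta k <= vnorm (vsum (fun i => x (phi (s i))) k)).

Definition linear_subspace {V : NormedSpace} (E : V -> Prop) : Prop :=
  E vzero /\ (forall x y, E x -> E y -> E (vadd x y)) /\
  (forall a x, E x -> E (vscal a x)).

Definition finite_codim {V : NormedSpace} (E : V -> Prop) : Prop :=
  linear_subspace E /\
  exists (n : nat) (e : nat -> V), forall y : V,
    exists (c : nat -> R) (z : V), E z /\
      y = vadd (vsum (fun i => vscal (c i) (e i)) n) z.

(** [rho_bar_le Y t B] unfolds  rho_bar_Y(t) <= B, where
    rho_bar_Y(t) = sup_{||y||=1} inf_{dim(Y/E)<oo} sup_{h in E, ||h||=1} ||y+th|| - 1. *)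
Definition rho_bar_le (Y : NormedSpace) (t B : R) : Prop :=
  forall y : Y, vnorm y = 1 ->
    forall eps, 0 < eps ->
      exists E : Y -> Prop, finite_codim E /\
        forall h : Y, E h -> vnorm h = 1 ->
          vnorm (vadd y (vscal t h)) - 1 <= B + eps.

Definition asymptotically_uniformly_smooth (q : R) (Y : NormedSpace) : Prop :=
  exists C, forall t, 0 <= t <= 1 -> rho_bar_le Y t (C * rpow t q).

(** omega_f(t) < oo for all t, and rho_f(t) -> oo *)
Definition coarse_embedding {X Y : NormedSpace} (f : X -> Y) : Prop :=
  (forall t, exists M, forall x y, dist x y <= t -> dist (f x) (f y) <= M) /\
  (forall M, exists T, forall t, T <= t -> forall x y, dist x y >= t ->
       dist (f x) (f y) >= M).

(** [compression_le X Y c] unfolds alpha_Y(X) <= c (with c >= 0):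
    every admissible exponent alpha is <= c. *)
Definition compression_le (X Y : NormedSpace) (c : R) : Prop :=
  forall alpha, 0 < alpha ->
    forall (f : X -> Y) (L : R), coarse_embedding f -> 0 < L ->
      (forall x y, dist (f x) (f y) >= / L * rpow (dist x y) alpha - L) ->
      alpha <= c.

(** omega_f(t) <= L t + L and rho_f(t) >= t/L - L for all t >= 0 *)
Definition coarse_Lipschitz_embedding {X Y : NormedSpace} (f : X -> Y) (L : R) : Prop :=
  0 < L /\
  (forall t x y, 0 <= t -> dist x y <= t -> dist (f x) (f y) <= L * t + L) /\
  (forall t x y, 0 <= t -> dist x y >= t -> dist (f x) (f y) >= / L * t - L).

(* Main.v *)
From Stdlib Require Import Reals Lra Lia List Classical ClassicalEpsilon.
From mathcomp Require filter.
Require Import Defs.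
Import ListNotations.
Open Scope R_scope.

(** Let [f] be a coarse map on [X] and [(x_n)] a separated sequence in the unit
    sphere. Fix a free ultrafilter. Since [Y] is reflexive, bounded sequences have
    weak limits along it, and [T g (z) = w-lim_n g (z + x_n)] turns a map that
    oscillates by at most [A] when one summand [x_n] is exchanged into another
    such map. Replacing the weak limits in [T^k f (0)] one by one by actual values
    adds a weakly null perturbation of norm at most [A] at each of [k] steps;
    by asymptotic [q]-smoothness the total displacement is [O(k^(1/q))]. A diagonal
    choice gives a subsequence along which, for every [k], the [f]-images of all
    sums of [k] late terms lie in one ball of radius [O(k^(1/q))].

    Put [y_n = x_(m_2n) - x_(m_(2n+1))] for this subsequence. If [f] has compression
    exponent [alpha], then sums of [k] late terms of [y] have norm [O(k^b)] with
    [b = 1 / (q alpha)]. If [b < 1/p < 1], such sublinear sums force [(y_n)] to be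
    weakly null, and then the almost [p]-co-Banach-Saks property gives the
    contradictory lower bound [k^(1/p) / theta_k]. So neither Rosenthal's theorem
    nor a prior choice of a weakly null sequence is needed. *)

(** * Vector algebra *)

Lemma vscal_0_l (V : NormedSpace) (x : V) : vscal 0 x = vzero.
Proof.
  rewrite <- (vadd_zero V (vscal 0 x)), <- (vadd_opp V (vscal 0 x)).
  rewrite vadd_assoc, <- vscal_addl, Rplus_0_l. reflexivity.
Qed.

Lemma vopp_scal (V : NormedSpace) (x : V) : vopp x = vscal (-1) x.
Proof.
  rewrite <- (vadd_zero V (vscal (-1) x)), <- (vadd_opp V x), vadd_assoc.
  rewrite <- (vscal_one V x) at 3. rewrite <- vscal_addl.
  replace (-1 + 1) with 0 by lra.
  rewrite vscal_0_l, vadd_comm, vadd_zero. reflexivity.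
Qed.

Lemma vscal_0_r (V : NormedSpace) (a : R) : vscal a (@vzero V) = vzero.
Proof.
  rewrite <- (vscal_0_l V vzero), vscal_assoc, Rmult_0_r. reflexivity.
Qed.

(** Reified linear expressions. Only vectors become atoms; scalars stay real terms, so an identity
    between vectors reduces to real equations between coefficients. *)
Inductive vexpr :=
  | VVar (i : nat)
  | VZero
  | VAdd (s t : vexpr)
  | VOpp (s : vexpr)
  | VScal (a : R) (s : vexpr).

Fixpoint veval {V : NormedSpace} (env : list V) (s : vexpr) : V :=
  match s with
  | VVar i => nth i env vzero
  | VZero => vzero
  | VAdd s t => vadd (veval env s) (veval env t)
  | VOpp s => vopp (veval env s)
  | VScal a s => vscal a (veval env s)
  end.

Fixpoint vcoef (s : vexpr) (i : nat) : R :=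
  match s with
  | VVar j => if Nat.eqb j i then 1 else 0
  | VZero => 0
  | VAdd s t => vcoef s i + vcoef t i
  | VOpp s => - vcoef s i
  | VScal a s => a * vcoef s i
  end.

Fixpoint vcomb {V : NormedSpace} (c : nat -> R) (env : list V) : V :=
  match env with
  | [] => vzero
  | e :: env => vadd (vscal (c O) e) (vcomb (fun i => c (S i)) env)
  end.

Lemma vcomb_add (V : NormedSpace) (env : list V) : forall c d : nat -> R,
  vcomb (fun i => c i + d i) env = vadd (vcomb c env) (vcomb d env).
Proof.
  induction env as [|e env IH]; intros c d; simpl.
  - rewrite vadd_zero. reflexivity.
  - rewrite (IH (fun i => c (S i)) (fun i => d (S i))), vscal_addl, !vadd_assoc.
    f_equal. rewrite <- !vadd_assoc. f_equal. apply vadd_comm.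
Qed.

Lemma vcomb_scal (V : NormedSpace) (a : R) (env : list V) : forall c : nat -> R,
  vcomb (fun i => a * c i) env = vscal a (vcomb c env).
Proof.
  induction env as [|e env IH]; intros c; simpl.
  - rewrite vscal_0_r. reflexivity.
  - rewrite (IH (fun i => c (S i))), vscal_addr, vscal_assoc. reflexivity.
Qed.

Lemma vcomb_ext (V : NormedSpace) (env : list V) : forall c d : nat -> R,
  (forall i, (i < length env)%nat -> c i = d i) -> vcomb c env = vcomb d env.
Proof.
  induction env as [|e env IH]; intros c d H; simpl; [reflexivity|].
  rewrite (H O) by (simpl; lia). f_equal. apply IH.
  intros i Hi. apply H. simpl; lia.
Qed.

Lemma vcomb_0 (V : NormedSpace) (env : list V) : vcomb (fun _ => 0) env = vzero.
Proof.
  induction env as [|e env IH]; simpl; [reflexivity|].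
  rewrite IH, vscal_0_l. apply vadd_zero.
Qed.

Lemma vcomb_var (V : NormedSpace) (env : list V) : forall j,
  vcomb (fun i => if Nat.eqb j i then 1 else 0) env = nth j env vzero.
Proof.
  induction env as [|e env IH]; intros [|j]; simpl; try reflexivity.
  - rewrite (vcomb_0 V env), vscal_one. apply vadd_zero.
  - rewrite (IH j), vscal_0_l, vadd_comm. apply vadd_zero.
Qed.

Lemma veval_coef (V : NormedSpace) (env : list V) (s : vexpr) :
  veval env s = vcomb (vcoef s) env.
Proof.
  induction s as [i| |s IHs t IHt|s IHs|a s IHs]; simpl.
  - symmetry. apply vcomb_var.
  - symmetry. apply vcomb_0.
  - rewrite IHs, IHt. symmetry. apply vcomb_add.
  - rewrite IHs, vopp_scal, <- vcomb_scal. apply vcomb_ext. intros; ring.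
  - rewrite IHs. symmetry. apply vcomb_scal.
Qed.

(** A bounded quantifier that computes: for a concrete environment it unfolds to one real equation
    per atom. *)
Fixpoint forall_below (n : nat) (P : nat -> Prop) : Prop :=
  match n with
  | O => True
  | S n => forall_below n P /\ P n
  end.

Lemma forall_below_lt (n : nat) (P : nat -> Prop) :
  forall_below n P -> forall i, (i < n)%nat -> P i.
Proof.
  induction n as [|n IH]; simpl; intros H i Hi; [lia|].
  destruct (Nat.eq_dec i n) as [->|]; [tauto|]. apply IH; [tauto|lia].
Qed.

Lemma veval_eq (V : NormedSpace) (env : list V) (s t : vexpr) :
  forall_below (length env) (fun i => vcoef s i = vcoef t i) ->
  veval env s = veval env t.
Proof.
  intros H. rewrite !veval_coef. apply vcomb_ext, forall_below_lt, H.
Qed.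

Ltac v_index x env :=
  match env with
  | x :: _ => constr:(O)
  | _ :: ?l => let i := v_index x l in constr:(S i)
  end.

Ltac v_atoms e env :=
  lazymatch e with
  | vadd ?a ?b => let env := v_atoms a env in v_atoms b env
  | vsub ?a ?b => let env := v_atoms a env in v_atoms b env
  | vopp ?a => v_atoms a env
  | vscal _ ?a => v_atoms a env
  | vzero => env
  | ?x => match env with
          | _ => let i := v_index x env in env
          | _ => constr:(x :: env)
          end
  end.

Ltac v_reify e env :=
  lazymatch e with
  | vadd ?a ?b =>
      let s := v_reify a env in let t := v_reify b env in constr:(VAdd s t)
  | vsub ?a ?b =>
      let s := v_reify a env in let t := v_reify b env in constr:(VAdd s (VOpp t))
  | vopp ?a => let s := v_reify a env in constr:(VOpp s)
  | vscal ?c ?a => let s := v_reify a env in constr:(VScal c s)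
  | vzero => constr:(VZero)
  | ?x => let i := v_index x env in constr:(VVar i)
  end.

(* Decides linear identities between vectors by comparing the coefficients of
   the atoms, which must agree as elements of the field R. *)
Ltac vec :=
  lazymatch goal with
  | |- @eq (carrier ?V) ?a ?b =>
      let env := v_atoms a (@nil (carrier V)) in
      let env := v_atoms b env in
      let s := v_reify a env in
      let t := v_reify b env in
      change (veval env s = veval env t); apply veval_eq;
      cbn [forall_below length vcoef Nat.eqb];
      repeat split; try lra; try (field; lra)
  end.

Lemma vnorm_0 (V : NormedSpace) : vnorm (@vzero V) = 0.
Proof. rewrite <- (vscal_0_l V vzero), vnorm_scal, Rabs_R0. ring. Qed.

Lemma vnorm_opp (V : NormedSpace) (x : V) : vnorm (vopp x) = vnorm x.
Proof. rewrite vopp_scal, vnorm_scal, Rabs_left by lra. ring. Qed.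

Lemma vnorm_ge_0 (V : NormedSpace) (x : V) : 0 <= vnorm x.
Proof.
  pose proof (vnorm_triangle V x (vopp x)) as H.
  rewrite vadd_opp, vnorm_0, vnorm_opp in H. lra.
Qed.

Lemma vnorm_pos (V : NormedSpace) (x : V) : x <> vzero -> 0 < vnorm x.
Proof.
  intros H. destruct (vnorm_ge_0 V x) as [|E]; [assumption|].
  elim H. apply vnorm_eq0. auto.
Qed.

Lemma vnorm_scal_pos (V : NormedSpace) (a : R) (x : V) :
  0 <= a -> vnorm (vscal a x) = a * vnorm x.
Proof. intros. rewrite vnorm_scal, Rabs_pos_eq; auto. Qed.

Lemma vnorm_sub_sym (V : NormedSpace) (x y : V) : vnorm (vsub x y) = vnorm (vsub y x).
Proof. rewrite <- (vnorm_opp V (vsub x y)). f_equal. vec. Qed.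

Lemma vnorm_le_add (V : NormedSpace) (x y z : V) :
  x = vadd y z -> vnorm x <= vnorm y + vnorm z.
Proof. intros ->. apply vnorm_triangle. Qed.

Lemma vsum_ext (V : NormedSpace) (g h : nat -> V) (n : nat) :
  (forall i, (i < n)%nat -> g i = h i) -> vsum g n = vsum h n.
Proof.
  induction n as [|n IH]; simpl; intros H; [reflexivity|].
  rewrite IH, H; auto.
Qed.

Lemma vsum_sub (V : NormedSpace) (g h : nat -> V) (n : nat) :
  vsum (fun i => vsub (g i) (h i)) n = vsub (vsum g n) (vsum h n).
Proof.
  induction n as [|n IH]; simpl; [vec|]. rewrite IH. vec.
Qed.

(** * Closed subspaces and bounded functionals *)

Definition closure {V : NormedSpace} (E : V -> Prop) (x : V) : Prop :=
  forall eps, 0 < eps -> exists z, E z /\ vnorm (vsub x z) < eps.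

Definition vclosed {V : NormedSpace} (E : V -> Prop) : Prop :=
  forall x, closure E x -> E x.

Definition add_line {V : NormedSpace} (E : V -> Prop) (e x : V) : Prop :=
  exists a, E (vsub x (vscal a e)).

(** The sum of [E] and the span of [l]. Finite codimension means that this is the whole space for
    some [l], which permits induction on the complementary directions. *)
Fixpoint add_lines {V : NormedSpace} (E : V -> Prop) (l : list V) : V -> Prop :=
  match l with
  | [] => E
  | e :: l => add_lines (add_line E e) l
  end.

Lemma subspace_comb (V : NormedSpace) (E : V -> Prop) (a b : R) (x y z : V) :
  linear_subspace E -> E x -> E y -> z = vadd (vscal a x) (vscal b y) -> E z.
Proof. intros (_ & Ha & Hs) Hx Hy ->. auto. Qed.

Lemma closure_subspace (V : NormedSpace) (E : V -> Prop) :
  linear_subspace E -> linear_subspace (closure E).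
Proof.
  intros HE. destruct HE as (H0 & Ha & Hs). split; [|split].
  - intros eps Heps. exists vzero. split; auto.
    replace (vsub vzero vzero) with (@vzero V) by vec. rewrite vnorm_0. auto.
  - intros x y Hx Hy eps Heps.
    destruct (Hx (eps / 2)) as (z & Hz & Dz); [lra|].
    destruct (Hy (eps / 2)) as (w & Hw & Dw); [lra|].
    exists (vadd z w). split; auto.
    pose proof (vnorm_le_add V (vsub (vadd x y) (vadd z w)) (vsub x z) (vsub y w)
      ltac:(vec)). lra.
  - intros a x Hx eps Heps.
    assert (Hp : 0 < Rabs a + 1) by (pose proof (Rabs_pos a); lra).
    destruct (Hx (eps / (Rabs a + 1))) as (z & Hz & Dz).
    { apply Rdiv_lt_0_compat; auto. }
    exists (vscal a z). split; auto.
    replace (vsub (vscal a x) (vscal a z)) with (vscal a (vsub x z)) by vec.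
    rewrite vnorm_scal.
    apply Rle_lt_trans with (Rabs a * (eps / (Rabs a + 1))).
    { apply Rmult_le_compat_l; [apply Rabs_pos|lra]. }
    replace eps with ((Rabs a + 1) * (eps / (Rabs a + 1))) at 2 by (field; lra).
    apply Rmult_lt_compat_r; [apply Rdiv_lt_0_compat; auto|lra].
Qed.

Lemma closure_closed (V : NormedSpace) (E : V -> Prop) : vclosed (closure E).
Proof.
  intros x Hx eps Heps.
  destruct (Hx (eps / 2)) as (y & Hy & Dy); [lra|].
  destruct (Hy (eps / 2)) as (z & Hz & Dz); [lra|].
  exists z. split; auto.
  pose proof (vnorm_le_add V (vsub x z) (vsub x y) (vsub y z) ltac:(vec)). lra.
Qed.

Lemma add_line_subspace (V : NormedSpace) (E : V -> Prop) (e : V) :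
  linear_subspace E -> linear_subspace (add_line E e).
Proof.
  intros HE. split; [|split].
  - exists 0. replace (vsub vzero (vscal 0 e)) with (@vzero V) by vec. apply HE.
  - intros x y [a Hx] [b Hy]. exists (a + b).
    apply (subspace_comb V E 1 1 _ _ _ HE Hx Hy). vec.
  - intros c x [a Hx]. exists (c * a).
    apply (subspace_comb V E c 0 _ _ _ HE Hx Hx). vec.
Qed.

(** Closedness gives [e] a positive distance [d] to [E]; factoring out [a] yields the scaled
    bound. *)
Lemma closed_gap (V : NormedSpace) (E : V -> Prop) (e : V) :
  linear_subspace E -> vclosed E -> ~ E e ->
  exists d, 0 < d /\ forall a z, E z -> Rabs a * d <= vnorm (vadd z (vscal a e)).
Proof.
  intros HE HC He.
  assert (H : exists d, 0 < d /\ forall z, E z -> d <= vnorm (vsub e z)).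
  { apply NNPP. intros N. apply He, HC. intros eps Heps. apply NNPP. intros M.
    apply N. exists eps. split; auto. intros z Hz.
    apply Rnot_lt_le. intros Hlt. apply M. exists z. auto. }
  destruct H as (d & Hd & H). exists d. split; auto. intros a z Hz.
  destruct (Req_dec a 0) as [->|Ha].
  - rewrite Rabs_R0, Rmult_0_l. apply vnorm_ge_0.
  - replace (vadd z (vscal a e)) with (vscal a (vsub e (vscal (- / a) z))) by vec.
    rewrite vnorm_scal. apply Rmult_le_compat_l; [apply Rabs_pos|].
    apply H, HE, Hz.
Qed.

Lemma inv_INR_pos (n : nat) : 0 < / INR (S n).
Proof. apply Rinv_0_lt_compat, lt_0_INR. lia. Qed.

Lemma inv_INR_small (eps : R) :
  0 < eps -> exists N, forall n, (N <= n)%nat -> / INR (S n) < eps.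
Proof.
  intros Heps. destruct (archimed_cor1 eps Heps) as (N & HN & HN0).
  exists N. intros n Hn. apply Rle_lt_trans with (/ INR N); auto.
  apply Rinv_le_contravar; [apply lt_0_INR; auto|apply le_INR; lia].
Qed.

(** If [e] lies outside [E], the gap bounds differences of [e]-coefficients by differences of
    vectors. The coefficients of approximants of [x] are therefore Cauchy, and their limit is the
    coefficient of [x]. *)
Lemma add_line_closed (V : NormedSpace) (E : V -> Prop) (e : V) :
  linear_subspace E -> vclosed E -> vclosed (add_line E e).
Proof.
  intros HE HC x Hx.
  destruct (classic (E e)) as [He|He].
  { exists 0. apply HC. intros eps Heps. destruct (Hx eps Heps) as (z & [a Hz] & Dz).
    exists z. split.
    - apply (subspace_comb V E 1 a _ _ _ HE Hz He). vec.
    - replace (vsub (vsub x (vscal 0 e)) z) with (vsub x z) by vec. auto. }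
  destruct (closed_gap V E e HE HC He) as (d & Hd & Hgap).
  assert (Hs : forall n, exists a, exists z, E z /\
      vnorm (vsub x (vadd z (vscal a e))) < / INR (S n)).
  { intros n. destruct (Hx _ (inv_INR_pos n)) as (w & [a Hw] & Dw).
    exists a, (vsub w (vscal a e)). split; auto.
    replace (vadd (vsub w (vscal a e)) (vscal a e)) with w by vec. auto. }
  apply choice in Hs. destruct Hs as [a Hs].
  assert (HCau : Cauchy_crit a).
  { intros eps Heps.
    destruct (inv_INR_small (eps * d / 2)) as [N HN].
    { apply Rdiv_lt_0_compat; [apply Rmult_lt_0_compat|]; lra. }
    exists N. intros n m Hn Hm. unfold Rdist.
    destruct (Hs n) as (z & Hz & Dz). destruct (Hs m) as (w & Hw & Dw).
    pose proof (HN n Hn). pose proof (HN m Hm).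
    assert (E1 : E (vsub z w)) by (apply (subspace_comb V E 1 (-1) z w _ HE Hz Hw); vec).
    pose proof (Hgap (a n - a m) _ E1).
    pose proof (vnorm_le_add V (vadd (vsub z w) (vscal (a n - a m) e))
      (vsub x (vadd w (vscal (a m) e))) (vsub (vadd z (vscal (a n) e)) x) ltac:(vec)).
    rewrite (vnorm_sub_sym V (vadd z (vscal (a n) e)) x) in *.
    apply Rmult_lt_reg_r with d; lra. }
  destruct (R_complete a HCau) as [b Hb]. exists b. apply HC. intros eps Heps.
  assert (Hp : 0 < vnorm e + 1) by (pose proof (vnorm_ge_0 V e); lra).
  destruct (inv_INR_small (eps / 2)) as [N HN]; [lra|].
  destruct (Hb (eps / 2 / (vnorm e + 1))) as [M HM].
  { apply Rdiv_lt_0_compat; lra. }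
  specialize (HN (N + M)%nat ltac:(lia)). specialize (HM (N + M)%nat ltac:(lia)).
  unfold Rdist in HM. destruct (Hs (N + M)%nat) as (z & Hz & Dz).
  exists z. split; auto.
  pose proof (vnorm_le_add V (vsub (vsub x (vscal b e)) z)
    (vsub x (vadd z (vscal (a (N + M)%nat) e))) (vscal (a (N + M)%nat - b) e)
    ltac:(vec)) as H.
  rewrite vnorm_scal in H.
  assert (Rabs (a (N + M)%nat - b) * (vnorm e + 1) < eps / 2).
  { replace (eps / 2) with (eps / 2 / (vnorm e + 1) * (vnorm e + 1)) by (field; lra).
    apply Rmult_lt_compat_r; auto. }
  pose proof (Rabs_pos (a (N + M)%nat - b)). lra.
Qed.

Lemma add_lines_mono (V : NormedSpace) (l : list V) : forall E F : V -> Prop,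
  (forall x, E x -> F x) -> forall x, add_lines E l x -> add_lines F l x.
Proof.
  induction l as [|e l IH]; simpl; intros E F H x; auto.
  apply IH. intros y [a Hy]. exists a. auto.
Qed.

Lemma add_lines_subspace (V : NormedSpace) (l : list V) : forall E : V -> Prop,
  linear_subspace E -> linear_subspace (add_lines E l).
Proof.
  induction l as [|e l IH]; simpl; auto using add_line_subspace.
Qed.

Lemma add_lines_closed (V : NormedSpace) (l : list V) : forall E : V -> Prop,
  linear_subspace E -> vclosed E -> vclosed (add_lines E l).
Proof.
  induction l as [|e l IH]; simpl; auto using add_line_subspace, add_line_closed.
Qed.

Lemma add_lines_incl (V : NormedSpace) (l : list V) : forall (E : V -> Prop) x,
  E x -> add_lines E l x.
Proof.
  induction l as [|e l IH]; simpl; intros E x Hx; auto.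
  apply IH. exists 0. replace (vsub x (vscal 0 e)) with x by vec. auto.
Qed.

Lemma add_lines_in (V : NormedSpace) (l : list V) : forall (E : V -> Prop) e,
  E vzero -> In e l -> add_lines E l e.
Proof.
  induction l as [|e' l IH]; simpl; intros E e H0 H; [contradiction|].
  destruct H as [->|H].
  - apply add_lines_incl. exists 1. replace (vsub e (vscal 1 e)) with (@vzero V) by vec. auto.
  - apply IH; auto. exists 0. replace (vsub vzero (vscal 0 e')) with (@vzero V) by vec. auto.
Qed.

Lemma add_lines_of_vsum (V : NormedSpace) (e : nat -> V) (n : nat) :
  exists l, forall (E : V -> Prop) (c : nat -> R) (z : V), E z ->
    add_lines E l (vadd (vsum (fun i => vscal (c i) (e i)) n) z).
Proof.
  induction n as [|n [l IH]].
  - exists []. intros E c z Hz. simpl.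
    replace (vadd vzero z) with z by vec. auto.
  - exists (e n :: l). intros E c z Hz. simpl.
    rewrite <- vadd_assoc. apply IH. exists (c n).
    replace (vsub (vadd (vscal (c n) (e n)) z) (vscal (c n) (e n))) with z by vec. auto.
Qed.

Lemma vsum_of_add_lines (V : NormedSpace) (l : list V) :
  exists e : nat -> V, forall (E : V -> Prop) x, add_lines E l x ->
    exists c z, E z /\ x = vadd (vsum (fun i => vscal (c i) (e i)) (length l)) z.
Proof.
  induction l as [|e l [f IH]].
  - exists (fun _ => vzero). intros E x Hx. exists (fun _ => 0), x. split; auto.
    simpl. vec.
  - exists (fun i => if Nat.eqb i (length l) then e else f i). intros E x Hx.
    destruct (IH _ x Hx) as (c & w & [a Hw] & ->).
    exists (fun i => if Nat.eqb i (length l) then a else c i), (vsub w (vscal a e)).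
    split; auto. simpl. rewrite Nat.eqb_refl.
    rewrite (vsum_ext V (fun i => vscal (c i) (f i))
      (fun i => vscal (if Nat.eqb i (length l) then a else c i)
                  (if Nat.eqb i (length l) then e else f i))).
    + vec.
    + intros i Hi. rewrite (proj2 (Nat.eqb_neq i (length l))) by lia. reflexivity.
Qed.

Lemma finite_codim_add_lines (V : NormedSpace) (E : V -> Prop) :
  finite_codim E -> exists l, forall x, add_lines E l x.
Proof.
  intros (_ & n & e & H). destruct (add_lines_of_vsum V e n) as [l Hl].
  exists l. intros x. destruct (H x) as (c & z & Hz & ->). auto.
Qed.

(** A Hahn-Banach statement in finite codimension, proved by elementary means. With no further
    directions, [phi] is the coordinate along [e], bounded because of the gap. Otherwise each
    direction in [l] is either redundant or absorbed into [E]. *)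
Lemma separating_functional (V : NormedSpace) (l : list V) :
  forall (E : V -> Prop) (e : V),
  linear_subspace E -> vclosed E -> ~ E e -> (forall x, add_lines (add_line E e) l x) ->
  exists phi, bounded_linear phi /\ phi e = 1 /\ forall z, E z -> phi z = 0.
Proof.
  induction l as [|e' l IH]; simpl; intros E e HE HC He Hfull.
  - destruct (closed_gap V E e HE HC He) as (d & Hd & Hgap).
    apply choice in Hfull. destruct Hfull as [phi Hphi].
    assert (Huniq : forall x a, E (vsub x (vscal a e)) -> phi x = a).
    { intros x a Hx.
      assert (E0 : E (vscal (phi x - a) e)).
      { apply (subspace_comb V E 1 (-1) _ _ _ HE Hx (Hphi x)). vec. }
      apply NNPP. intros Hne. apply He.
      apply (subspace_comb V E (/ (phi x - a)) 0 _ _ _ HE E0 E0). vec. }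
    exists phi. split; [split|split].
    + split.
      * intros x y. apply Huniq.
        apply (subspace_comb V E 1 1 _ _ _ HE (Hphi x) (Hphi y)). vec.
      * intros a x. apply Huniq.
        apply (subspace_comb V E a 0 _ _ _ HE (Hphi x) (Hphi x)). vec.
    + exists (/ d). split; [left; apply Rinv_0_lt_compat; auto|]. intros x.
      apply Rmult_le_reg_r with d; auto.
      replace (/ d * vnorm x * d) with (vnorm x) by (field; lra).
      replace x with (vadd (vsub x (vscal (phi x) e)) (vscal (phi x) e)) at 2 by vec.
      apply Hgap, Hphi.
    + apply Huniq. replace (vsub e (vscal 1 e)) with (@vzero V) by vec. apply HE.
    + intros z Hz. apply Huniq. replace (vsub z (vscal 0 e)) with z by vec. auto.
  - destruct (classic (add_line E e' e)) as [[c Hc]|Hn].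
    + apply (IH E e HE HC He). intros x.
      apply (add_lines_mono V l (add_line (add_line E e) e')); auto.
      intros y [a [b Hab]].
      destruct (Req_dec c 0) as [->|Hc0].
      { elim He. replace e with (vsub e (vscal 0 e')) by vec. auto. }
      exists (b + a / c).
      apply (subspace_comb V E 1 (- (a / c)) _ _ _ HE Hab Hc). vec.
    + destruct (IH (add_line E e') e) as (phi & Hb & H1 & H0);
        auto using add_line_subspace, add_line_closed.
      * intros x. apply (add_lines_mono V l (add_line (add_line E e) e')); auto.
        intros y [a [b Hab]]. exists b, a.
        apply (subspace_comb V E 1 0 _ _ _ HE Hab Hab). vec.
      * exists phi. split; [|split]; auto. intros z Hz. apply H0. exists 0.
        replace (vsub z (vscal 0 e')) with z by vec. auto.
Qed.

(** * Ultrafilters on the natural numbers *)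

Record free_ultrafilter (U : (nat -> Prop) -> Prop) : Prop := {
  uf_mono : forall P Q : nat -> Prop, U P -> (forall n, P n -> Q n) -> U Q;
  uf_and : forall P Q : nat -> Prop, U P -> U Q -> U (fun n => P n /\ Q n);
  uf_or_not : forall P : nat -> Prop, U P \/ U (fun n => ~ P n);
  uf_tail : forall N, U (fun n => (N <= n)%nat);
  uf_ex : forall P : nat -> Prop, U P -> exists n, P n
}.

Lemma free_ultrafilter_exists : exists U, free_ultrafilter U.
Proof.
  (* The filter of cofinite sets; any ultrafilter extending it is free. *)
  pose (F := (fun P : nat -> Prop => exists N, forall n, (N <= n)%nat -> P n)).
  assert (HF : filter.ProperFilter F).
  { constructor.
    - intros (N & HN). exact (HN N (le_n N)).
    - constructor.
      + exists O. intros; exact I.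
      + intros P Q (N & HN) (M & HM). exists (N + M)%nat. intros n Hn.
        split; [apply HN|apply HM]; lia.
      + intros P Q HPQ (N & HN). exists N. intros n Hn. apply HPQ, HN, Hn. }
  destruct (filter.ultraFilterLemma HF) as (U & HU & HFU).
  pose proof (@filter.ultra_proper _ _ HU) as HP.
  exists U. constructor.
  - intros P Q H1 H2. exact (filter.filterS H2 H1).
  - intros P Q H1 H2. exact (filter.filterI H1 H2).
  - intros P. exact (filter.in_ultra_setVsetC P HU).
  - intros N. apply HFU. exists N. auto.
  - intros P H1. exact (filter.filter_ex H1).
Qed.

Definition ulim (U : (nat -> Prop) -> Prop) (a : nat -> R) (l : R) : Prop :=
  forall eps, 0 < eps -> U (fun n => Rabs (a n - l) < eps).

(** The limit is the supremum of all [r] such that [r <= a n] holds on a set of the ultrafilter. *)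
Lemma ulim_exists (U : (nat -> Prop) -> Prop) (a : nat -> R) (M : R) :
  free_ultrafilter U -> (forall n, Rabs (a n) <= M) -> exists l, ulim U a l.
Proof.
  intros HU HM.
  destruct (completeness (fun r => U (fun n => r <= a n))) as [l [Hub Hlub]].
  - exists M. intros r Hr. destruct (uf_ex U HU _ Hr) as [n Hn].
    pose proof (Rle_abs (a n)). specialize (HM n). lra.
  - exists (- M). apply (uf_mono U HU _ _ (uf_tail U HU O)). intros n _.
    pose proof (Rle_abs (- a n)) as H. rewrite Rabs_Ropp in H. specialize (HM n). lra.
  - exists l. intros eps Heps.
    assert (H1 : U (fun n => a n < l + eps)).
    { destruct (uf_or_not U HU (fun n => l + eps <= a n)) as [H|H].
      - pose proof (Hub _ H). lra.
      - apply (uf_mono U HU _ _ H). intros; lra. }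
    assert (H2 : U (fun n => l - eps < a n)).
    { destruct (uf_or_not U HU (fun n => l - eps < a n)) as [H|H]; auto. exfalso.
      assert (Hc : l <= l - eps); [|lra]. apply Hlub. intros r Hr.
      destruct (uf_ex U HU _ (uf_and U HU _ _ H Hr)) as (n & Hn & Hn'). lra. }
    apply (uf_mono U HU _ _ (uf_and U HU _ _ H1 H2)). intros n [Hn Hn'].
    apply Rabs_def1; lra.
Qed.

Lemma ulim_unique (U : (nat -> Prop) -> Prop) (a : nat -> R) (l m : R) :
  free_ultrafilter U -> ulim U a l -> ulim U a m -> l = m.
Proof.
  intros HU Hl Hm. apply cond_eq. intros eps Heps.
  destruct (uf_ex U HU _ (uf_and U HU _ _ (Hl (eps / 2) ltac:(lra))
    (Hm (eps / 2) ltac:(lra)))) as (n & H1 & H2).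
  apply Rabs_def2 in H1, H2. apply Rabs_def1; lra.
Qed.

Lemma ulim_comb (U : (nat -> Prop) -> Prop) (a b c : nat -> R) (s t l m : R) :
  free_ultrafilter U -> ulim U a l -> ulim U b m ->
  (forall n, c n = s * a n + t * b n) -> ulim U c (s * l + t * m).
Proof.
  intros HU Hl Hm Hc eps Heps.
  set (K := Rabs s + Rabs t + 1).
  assert (HK : 0 < K) by (unfold K; pose proof (Rabs_pos s); pose proof (Rabs_pos t); lra).
  assert (Hd : 0 < eps / K) by (apply Rdiv_lt_0_compat; auto).
  apply (uf_mono U HU _ _ (uf_and U HU _ _ (Hl _ Hd) (Hm _ Hd))).
  intros n [H1 H2]. rewrite Hc.
  replace (s * a n + t * b n - (s * l + t * m))
    with (s * (a n - l) + t * (b n - m)) by ring.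
  eapply Rle_lt_trans; [apply Rabs_triang|]. rewrite !Rabs_mult.
  apply Rle_lt_trans with ((Rabs s + Rabs t) * (eps / K)).
  - rewrite Rmult_plus_distr_r.
    apply Rplus_le_compat; apply Rmult_le_compat_l; auto using Rabs_pos; lra.
  - replace eps with (K * (eps / K)) at 2 by (field; lra).
    apply Rmult_lt_compat_r; auto. unfold K; lra.
Qed.

Lemma ulim_bound (U : (nat -> Prop) -> Prop) (a : nat -> R) (l M : R) :
  free_ultrafilter U -> ulim U a l -> (forall n, Rabs (a n) <= M) -> Rabs l <= M.
Proof.
  intros HU Hl HM. apply le_epsilon. intros eps Heps.
  destruct (uf_ex U HU _ (Hl _ Heps)) as [n Hn]. specialize (HM n).
  rewrite Rabs_minus_sym in Hn. pose proof (Rabs_triang (l - a n) (a n)) as H.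
  replace (l - a n + a n) with l in H by ring. lra.
Qed.

(** * Weak limits along an ultrafilter *)

Definition wulim {V : NormedSpace} (U : (nat -> Prop) -> Prop) (v : nat -> V) (y : V) : Prop :=
  forall phi : V -> R, bounded_linear phi -> ulim U (fun n => phi (v n)) (phi y).

Lemma functional_comb (V : NormedSpace) (phi : V -> R) (s t : R) (x y z : V) :
  bounded_linear phi -> z = vadd (vscal s x) (vscal t y) -> phi z = s * phi x + t * phi y.
Proof.
  intros [[Ha Hs] _] ->. rewrite Ha, !Hs. reflexivity.
Qed.

Lemma wulim_comb (V : NormedSpace) (U : (nat -> Prop) -> Prop) (u v w : nat -> V)
    (s t : R) (x y z : V) :
  free_ultrafilter U -> wulim U u x -> wulim U v y ->
  (forall n, w n = vadd (vscal s (u n)) (vscal t (v n))) ->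
  z = vadd (vscal s x) (vscal t y) -> wulim U w z.
Proof.
  intros HU Hu Hv Hw Hz phi Hphi.
  rewrite (functional_comb V phi s t x y z Hphi Hz).
  apply (ulim_comb U (fun n => phi (u n)) (fun n => phi (v n))); auto.
  intros n. apply functional_comb; auto.
Qed.

Lemma wulim_const (V : NormedSpace) (U : (nat -> Prop) -> Prop) (y : V) :
  free_ultrafilter U -> wulim U (fun _ => y) y.
Proof.
  intros HU phi _ eps Heps. apply (uf_mono U HU _ _ (uf_tail U HU O)). intros n _.
  rewrite Rminus_diag, Rabs_R0. auto.
Qed.

(** The limit of [f (v n)] along [U] is a bounded linear function of [f], that is, an element of the
    bidual; reflexivity represents it by a point. *)
Lemma wulim_exists (V : NormedSpace) (U : (nat -> Prop) -> Prop) (v : nat -> V) (M : R) :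
  free_ultrafilter U -> reflexive V -> (forall n, vnorm (v n) <= M) ->
  exists y, wulim U v y.
Proof.
  intros HU HR HM.
  assert (Hb : forall f K n, bound_by f K -> Rabs (f (v n)) <= M * K).
  { intros f K n [HK Hf]. eapply Rle_trans; [apply Hf|].
    rewrite Rmult_comm. apply Rmult_le_compat_r; auto. }
  set (Phi := fun f : V -> R => epsilon (inhabits 0) (fun l => ulim U (fun n => f (v n)) l)).
  assert (HPhi : forall f, bounded_linear f -> ulim U (fun n => f (v n)) (Phi f)).
  { intros f [_ [K HK]]. apply (epsilon_spec (inhabits 0)).
    apply (ulim_exists U _ (M * K)); auto. }
  destruct (HR Phi) as [y Hy].
  - intros f g h a b Hf Hg Hh.
    assert (HL : ulim U (fun n => h (v n)) (a * Phi f + b * Phi g)).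
    { apply (ulim_comb U (fun n => f (v n)) (fun n => g (v n))); auto. }
    apply (ulim_unique U (fun n => h (v n))); auto.
    (* Here [h] is known only as a pointwise combination, so the existence of its limit comes from
       [HL]. *)
    apply (epsilon_spec (inhabits 0) (fun l => ulim U (fun n => h (v n)) l)). eauto.
  - exists M. split; [apply Rle_trans with (vnorm (v O)); auto using vnorm_ge_0|].
    intros f K Hf HK. apply (ulim_bound U (fun n => f (v n))); auto.
  - exists y. intros phi Hphi. rewrite <- Hy; auto.
Qed.

(** By induction [h n] is close to some [w = z + a e] with [z] in [E]. A functional vanishing on [E]
    with value 1 at [e] reads off [a], which is small because [h] is weakly null; so [a e] can be
    discarded. *)
Lemma weakly_null_near_closed_subspace (V : NormedSpace) (U : (nat -> Prop) -> Prop)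
    (h : nat -> V) (l : list V) :
  free_ultrafilter U -> wulim U h vzero ->
  forall E : V -> Prop, linear_subspace E -> vclosed E -> (forall x, add_lines E l x) ->
  forall eps, 0 < eps -> U (fun n => exists z, E z /\ vnorm (vsub (h n) z) < eps).
Proof.
  intros HU Hh. induction l as [|e l IH]; simpl; intros E HE HC Hfull eps Heps.
  - apply (uf_mono U HU _ _ (uf_tail U HU O)). intros n _. exists (h n).
    split; auto. replace (vsub (h n) (h n)) with (@vzero V) by vec. rewrite vnorm_0; auto.
  - destruct (classic (E e)) as [He|He].
    { apply IH; auto. intros x. apply (add_lines_mono V l (add_line E e)); auto.
      intros y [a Hy]. apply (subspace_comb V E 1 a _ _ _ HE Hy He). vec. }
    destruct (separating_functional V l E e HE HC He Hfull) as (phi & Hphi & H1 & H0).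
    destruct Hphi as [Hlin [M [HM Hbd]]].
    pose proof (vnorm_ge_0 V e) as He0.
    (* With tolerance [eps / K], the distance to [w] costs one share. Since
       [|a| <= |phi (h n) - a| + |phi (h n)|], discarding [a e] costs at most [(M + 1) * vnorm e]
       shares. *)
    set (K := 1 + (M + 1) * vnorm e).
    assert (HK : 0 < K).
    { unfold K. assert (0 <= (M + 1) * vnorm e) by (apply Rmult_le_pos; lra). lra. }
    assert (Hd : 0 < eps / K) by (apply Rdiv_lt_0_compat; auto).
    assert (A1 := IH _ (add_line_subspace V E e HE) (add_line_closed V E e HE HC) Hfull _ Hd).
    assert (A2 := Hh phi (conj Hlin (ex_intro _ M (conj HM Hbd))) _ Hd).
    apply (uf_mono U HU _ _ (uf_and U HU _ _ A1 A2)). intros n [(w & [a Ha] & Dw) Dphi].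
    exists (vsub w (vscal a e)). split; auto.
    assert (Hp0 : phi vzero = 0).
    { apply H0, HE. }
    rewrite Hp0, Rminus_0_r in Dphi.
    assert (Hpw : phi (vsub (h n) w) = phi (h n) - a).
    { assert (Hb : bounded_linear phi) by (exact (conj Hlin (ex_intro _ M (conj HM Hbd)))).
      rewrite (functional_comb V phi 1 (-1) (h n) w (vsub (h n) w) Hb) by vec.
      rewrite (functional_comb V phi 1 a (vsub w (vscal a e)) e w Hb) by vec.
      rewrite (H0 _ Ha), H1. ring. }
    pose proof (Hbd (vsub (h n) w)) as Hw. rewrite Hpw in Hw.
    assert (Ha1 : Rabs a <= (M + 1) * (eps / K)).
    { pose proof (Rabs_triang (- (phi (h n) - a)) (phi (h n))) as T.
      replace (- (phi (h n) - a) + phi (h n)) with a in T by ring.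
      rewrite Rabs_Ropp in T.
      assert (M * vnorm (vsub (h n) w) <= M * (eps / K)) by (apply Rmult_le_compat_l; lra).
      lra. }
    pose proof (vnorm_le_add V (vsub (h n) (vsub w (vscal a e))) (vsub (h n) w) (vscal a e)
      ltac:(vec)) as T.
    rewrite vnorm_scal in T.
    assert (Rabs a * vnorm e <= (M + 1) * (eps / K) * vnorm e)
      by (apply Rmult_le_compat_r; auto).
    replace eps with (eps / K + (M + 1) * (eps / K) * vnorm e); [lra|].
    unfold K. unfold K in HK. field. lra.
Qed.

Lemma weakly_null_near_subspace (V : NormedSpace) (U : (nat -> Prop) -> Prop)
    (h : nat -> V) (E : V -> Prop) :
  free_ultrafilter U -> wulim U h vzero -> finite_codim E ->
  forall eps, 0 < eps -> U (fun n => exists z, E z /\ vnorm (vsub (h n) z) < eps).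
Proof.
  intros HU Hh HE eps Heps.
  destruct (finite_codim_add_lines V E HE) as [l Hl]. destruct HE as [HE _].
  (* [E] need not be closed: the result is applied to its closure, whose points are then
     approximated from [E]. *)
  assert (Hl' : forall x, add_lines (closure E) l x).
  { intros x. apply (add_lines_mono V l E); auto. intros y Hy d Hd. exists y.
    split; auto. replace (vsub y y) with (@vzero V) by vec. rewrite vnorm_0; auto. }
  assert (H := weakly_null_near_closed_subspace V U h l HU Hh (closure E)
    (closure_subspace V E HE) (closure_closed V E) Hl' (eps / 2) ltac:(lra)).
  apply (uf_mono U HU _ _ H). intros n (w & Hw & Dw).
  destruct (Hw (eps / 2)) as (z & Hz & Dz); [lra|]. exists z. split; auto.
  pose proof (vnorm_le_add V (vsub (h n) z) (vsub (h n) w) (vsub w z) ltac:(vec)). lra.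
Qed.

(** * Asymptotic uniform smoothness along weakly null sequences *)

Definition smooth_with (q C : R) (Y : NormedSpace) : Prop :=
  0 < C /\ forall t, 0 <= t <= 1 -> rho_bar_le Y t (C * rpow t q).

Lemma rpow_pos (x a : R) : 0 < x -> rpow x a = Rpower x a.
Proof. intros H. unfold rpow. destruct (Rle_dec x 0); [lra|reflexivity]. Qed.

Lemma rpow_ge_0 (x a : R) : 0 <= rpow x a.
Proof.
  unfold rpow. destruct (Rle_dec x 0); [lra|]. left. apply exp_pos.
Qed.

Lemma Rpower_pos (x a : R) : 0 < Rpower x a.
Proof. apply exp_pos. Qed.

Lemma smooth_with_exists (q : R) (Y : NormedSpace) :
  asymptotically_uniformly_smooth q Y -> exists C, smooth_with q C Y.
Proof.
  intros [C HC]. exists (Rabs C + 1). split; [pose proof (Rabs_pos C); lra|].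
  intros t Ht y Hy eps Heps. destruct (HC t Ht y Hy eps Heps) as (E & HE & H).
  exists E. split; auto. intros h Hh Hn. specialize (H h Hh Hn).
  pose proof (rpow_ge_0 t q).
  assert (C * rpow t q <= (Rabs C + 1) * rpow t q).
  { apply Rmult_le_compat_r; auto. pose proof (Rle_abs C). lra. }
  lra.
Qed.

(* The subspace supplied by the modulus depends on [t]; convexity of
   [s |-> ||y + s h||] lets one subspace serve all perturbations of norm at most [t]. *)
Lemma smooth_ball (Y : NormedSpace) (E : Y -> Prop) (y : Y) (t B : R) :
  linear_subspace E -> vnorm y = 1 -> 0 < t -> 0 <= B ->
  (forall h, E h -> vnorm h = 1 -> vnorm (vadd y (vscal t h)) - 1 <= B) ->
  forall z d, E z -> 0 <= d -> vnorm z <= t + d -> vnorm (vadd y z) <= 1 + B + d.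
Proof.
  intros HE Hy Ht HB H z d Hz Hd Hzt.
  destruct (classic (z = vzero)) as [->|Hz0].
  { rewrite vadd_zero. lra. }
  apply vnorm_pos in Hz0. set (r := vnorm z) in *.
  assert (Hw1 : vnorm (vscal (/ r) z) = 1).
  { rewrite vnorm_scal_pos; [unfold r; field; unfold r in *; lra|].
    left. apply Rinv_0_lt_compat; auto. }
  assert (Hw : E (vscal (/ r) z)) by (apply HE; auto).
  specialize (H _ Hw Hw1).
  (* For [r <= t], the point [y + z] is a convex combination of [y] and the perturbation of size
     exactly [t]; for [r > t], the excess [r - t] is at most [d]. *)
  destruct (Rle_or_lt r t) as [Hrt|Hrt].
  - assert (Hq : 0 <= r / t <= 1).
    { split; [left; apply Rdiv_lt_0_compat; auto|].
      apply Rmult_le_reg_r with t; auto. unfold Rdiv. rewrite Rmult_assoc, Rinv_l; lra. }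
    pose proof (vnorm_le_add Y (vadd y z) (vscal (1 - r / t) y)
      (vscal (r / t) (vadd y (vscal t (vscal (/ r) z)))) ltac:(vec)) as T.
    rewrite !vnorm_scal_pos, Hy in T by lra.
    assert (r / t * vnorm (vadd y (vscal t (vscal (/ r) z))) <= r / t * (1 + B))
      by (apply Rmult_le_compat_l; lra).
    assert (r / t * B <= 1 * B) by (apply Rmult_le_compat_r; lra).
    lra.
  - pose proof (vnorm_le_add Y (vadd y z) (vadd y (vscal t (vscal (/ r) z)))
      (vscal (r - t) (vscal (/ r) z)) ltac:(vec)) as T.
    rewrite (vnorm_scal_pos Y (r - t)), Hw1 in T by lra. lra.
Qed.

Lemma smooth_weakly_null (Y : NormedSpace) (q C A : R) (U : (nat -> Prop) -> Prop)
    (h : nat -> Y) (v : Y) :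
  smooth_with q C Y -> free_ultrafilter U -> wulim U h vzero ->
  0 < A -> (forall n, vnorm (h n) <= A) -> A <= vnorm v ->
  forall eps, 0 < eps ->
  U (fun n => vnorm (vadd v (h n)) <= vnorm v * (1 + C * Rpower (A / vnorm v) q) + eps).
Proof.
  intros [HC HS] HU Hh HA HhA HvA eps Heps.
  set (r := vnorm v) in *. assert (Hr : 0 < r) by lra.
  assert (Ht : 0 < A / r) by (apply Rdiv_lt_0_compat; auto).
  assert (Ht1 : A / r <= 1).
  { apply Rmult_le_reg_r with r; auto. unfold Rdiv. rewrite Rmult_assoc, Rinv_l; lra. }
  assert (Hy : vnorm (vscal (/ r) v) = 1).
  { rewrite vnorm_scal_pos; [fold r; field; lra|]. left. apply Rinv_0_lt_compat; auto. }
  (* Three errors of size [d], after division by [r]: the slack in the modulus, the possible excess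
     of [vnorm z] over [A / r], and the replacement of [h n / r] by [z] in [E]. *)
  set (d := eps / r / 3). assert (Hd : 0 < d).
  { unfold d. apply Rdiv_lt_0_compat; [apply Rdiv_lt_0_compat|]; lra. }
  destruct (HS (A / r) ltac:(lra) _ Hy d Hd) as (E & HE & H).
  rewrite rpow_pos in H by auto.
  assert (Hg : wulim U (fun n => vscal (/ r) (h n)) vzero).
  { apply (wulim_comb Y U h h _ (/ r) 0 vzero vzero); auto.
    - intros n. vec.
    - vec. }
  apply (uf_mono U HU _ _ (weakly_null_near_subspace Y U _ E HU Hg HE d Hd)).
  intros n (z & Hz & Dz).
  assert (HB : 0 <= C * Rpower (A / r) q + d).
  { pose proof (Rmult_lt_0_compat _ _ HC (Rpower_pos (A / r) q)). lra. }
  assert (Hzn : vnorm z <= A / r + d).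
  { pose proof (vnorm_le_add Y z (vscal (/ r) (h n)) (vsub z (vscal (/ r) (h n)))
      ltac:(vec)) as T.
    rewrite vnorm_sub_sym, vnorm_scal_pos in T by (left; apply Rinv_0_lt_compat; auto).
    assert (/ r * vnorm (h n) <= A / r).
    { unfold Rdiv. rewrite Rmult_comm. apply Rmult_le_compat_r; auto.
      left; apply Rinv_0_lt_compat; auto. }
    lra. }
  pose proof (smooth_ball Y E _ _ _ (proj1 HE) Hy Ht HB H z d Hz (Rlt_le _ _ Hd) Hzn) as T1.
  pose proof (vnorm_le_add Y (vadd (vscal (/ r) v) (vscal (/ r) (h n)))
    (vadd (vscal (/ r) v) z) (vsub (vscal (/ r) (h n)) z) ltac:(vec)) as T2.
  replace (vadd v (h n)) with (vscal r (vadd (vscal (/ r) v) (vscal (/ r) (h n)))) by vec.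
  rewrite vnorm_scal_pos by lra.
  replace eps with (r * (3 * d)) by (unfold d; field; lra).
  rewrite <- Rmult_plus_distr_l. apply Rmult_le_compat_l; lra.
Qed.

(* Weak lower semicontinuity of the norm, obtained from smoothness instead of
   norming functionals: [(1 + s) v = (v - s h) + s (v + h)], and smoothness bounds
   [||v - s h||] by [||v|| + o(s)]. *)
Lemma wulim_norm_le (Y : NormedSpace) (q C A : R) (U : (nat -> Prop) -> Prop)
    (u : nat -> Y) (v : Y) :
  1 < q -> smooth_with q C Y -> free_ultrafilter U -> wulim U u v ->
  (forall n, vnorm (u n) <= A) -> vnorm v <= A.
Proof.
  intros Hq HS HU Hu HA. apply Rnot_lt_le. intros Hlt.
  assert (HA0 : 0 <= A) by (apply Rle_trans with (vnorm (u O)); auto using vnorm_ge_0).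
  set (r := vnorm v) in *. assert (Hr : 0 < r) by lra.
  assert (HC : 0 < C) by apply HS.
  (* The right-hand side tends to 0 with [s] because [q > 1], which contradicts [A < r]. *)
  assert (Key : forall s, 0 < s -> 2 * s <= 1 ->
      r - A <= 2 * r * C * Rpower (2 * s) (q - 1)).
  { intros s Hs Hs1.
    assert (Hh : wulim U (fun n => vscal (- s) (vsub (u n) v)) vzero).
    { apply (wulim_comb Y U u (fun _ => v) _ (- s) s v v); auto using wulim_const.
      - intros n. vec.
      - vec. }
    apply Rmult_le_reg_l with s; auto. apply le_epsilon. intros eps Heps.
    assert (HB : 0 < 2 * s * r) by (apply Rmult_lt_0_compat; lra).
    assert (Hb : forall n, vnorm (vscal (- s) (vsub (u n) v)) <= 2 * s * r).
    { intros n. rewrite vnorm_scal, Rabs_Ropp, Rabs_pos_eq by lra.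
      rewrite (Rmult_comm 2), Rmult_assoc. apply Rmult_le_compat_l; [lra|].
      pose proof (vnorm_le_add Y (vsub (u n) v) (u n) (vopp v) ltac:(vec)) as T.
      rewrite vnorm_opp in T. fold r in T. specialize (HA n). lra. }
    assert (Hbr : 2 * s * r <= r).
    { rewrite <- (Rmult_1_l r) at 2. apply Rmult_le_compat_r; lra. }
    destruct (uf_ex U HU _ (smooth_weakly_null Y q C (2 * s * r) U _ v HS HU Hh HB Hb Hbr
      eps Heps)) as [n Hn].
    fold r in Hn.
    replace (2 * s * r / r) with (2 * s) in Hn by (field; lra).
    pose proof (vnorm_le_add Y (vscal (1 + s) v)
      (vadd v (vscal (- s) (vsub (u n) v))) (vscal s (u n)) ltac:(vec)) as T.
    rewrite !(vnorm_scal_pos Y) in T by lra. fold r in T.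
    assert (s * vnorm (u n) <= s * A) by (apply Rmult_le_compat_l; [lra|auto]).
    replace (s * (2 * r * C * Rpower (2 * s) (q - 1)))
      with (r * C * Rpower (2 * s) q); [lra|].
    replace q with (q - 1 + 1) at 1 by ring.
    rewrite Rpower_plus, Rpower_1 by lra. ring. }
  (* With [2 s = m^(1/(q-1))] the bound in [Key] becomes [2 r C m], at most [(r - A) / 2]; the
     minimum with 1 ensures [2 s <= 1]. *)
  set (m := Rmin 1 ((r - A) / (4 * r * C))).
  assert (Hrc : 0 < 4 * r * C) by (apply Rmult_lt_0_compat; lra).
  assert (Hm0 : 0 < (r - A) / (4 * r * C)) by (apply Rdiv_lt_0_compat; lra).
  assert (Hm : 0 < m) by (unfold m; apply Rmin_pos; lra).
  assert (Hm1 : m <= 1) by apply Rmin_l.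
  assert (Hq1 : 0 < / (q - 1)) by (apply Rinv_0_lt_compat; lra).
  pose proof (Rpower_pos m (/ (q - 1))) as Hs0.
  assert (Hs1 : Rpower m (/ (q - 1)) <= 1).
  { unfold Rpower. apply Rle_trans with (exp 0); [|rewrite exp_0; lra].
    destruct Hm1 as [Hm1|Hm1].
    - left. apply exp_increasing. pose proof (ln_increasing m 1 Hm Hm1) as L.
      rewrite ln_1 in L. pose proof (Rmult_lt_compat_l _ _ _ Hq1 L). lra.
    - rewrite Hm1, ln_1, Rmult_0_r. lra. }
  specialize (Key (Rpower m (/ (q - 1)) / 2) ltac:(lra) ltac:(lra)).
  replace (2 * (Rpower m (/ (q - 1)) / 2)) with (Rpower m (/ (q - 1))) in Key by field.
  rewrite Rpower_mult, Rinv_l, Rpower_1 in Key by lra.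
  assert (m <= (r - A) / (4 * r * C)) by apply Rmin_r.
  assert (2 * r * C * m <= 2 * r * C * ((r - A) / (4 * r * C))).
  { apply Rmult_le_compat_l; auto. lra. }
  replace (2 * r * C * ((r - A) / (4 * r * C))) with ((r - A) / 2) in * by (field; lra).
  lra.
Qed.

(** * Growth of order [k^(1/q)] under weakly null perturbations *)

(** Concavity of the power. Two instances of [1 + t <= exp t], weighted by [a] and [1 - a], are
    added so that the terms in [ln x] cancel. *)
Lemma Rpower_le_tangent (x a : R) : 0 < x -> 0 <= a <= 1 -> Rpower x a <= 1 + a * (x - 1).
Proof.
  intros Hx Ha. unfold Rpower. set (l := ln x).
  assert (Hl : x = exp l) by (unfold l; rewrite exp_ln; auto).
  pose proof (exp_pos (a * l)) as Hp.
  assert (H1 : exp (a * l) * (1 + (1 - a) * l) <= x).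
  { rewrite Hl. replace l with (a * l + (1 - a) * l) at 3 by ring.
    rewrite exp_plus. apply Rmult_le_compat_l; [lra|]. apply exp_ineq1_le. }
  assert (H2 : exp (a * l) * (1 + - (a * l)) <= 1).
  { replace 1 with (exp (a * l + - (a * l))) at 2
      by (rewrite Rplus_opp_r; apply exp_0).
    rewrite exp_plus. apply Rmult_le_compat_l; [lra|]. apply exp_ineq1_le. }
  assert (H3 := Rmult_le_compat_l a _ _ ltac:(lra) H1).
  assert (H4 := Rmult_le_compat_l (1 - a) _ _ ltac:(lra) H2).
  lra.
Qed.

(** The tangent bound at [i / (i + 1)], multiplied by [(i + 1)^a]. The case [i = 0] rests on the
    convention that [rpow 0 a] is 0. *)
Lemma rpow_INR_increment (i : nat) (a : R) : 0 < a <= 1 ->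
  rpow (INR i) a + a * Rpower (INR (S i)) (a - 1) <= Rpower (INR (S i)) a.
Proof.
  intros Ha. assert (HS : 0 < INR (S i)) by (apply lt_0_INR; lia).
  assert (E : Rpower (INR (S i)) (a - 1) = Rpower (INR (S i)) a * / INR (S i)).
  { unfold Rminus. rewrite Rpower_plus, Rpower_Ropp, Rpower_1 by auto. reflexivity. }
  rewrite E. pose proof (Rpower_pos (INR (S i)) a) as Hp.
  destruct i as [|i].
  - unfold rpow. destruct (Rle_dec (INR 0) 0) as [_|N]; [|elim N; simpl; lra].
    simpl INR. rewrite Rinv_1. simpl INR in Hp.
    assert (a * Rpower 1 a <= 1 * Rpower 1 a) by (apply Rmult_le_compat_r; lra). lra.
  - set (n := INR (S (S i))) in *.
    assert (Hn : INR (S i) = n - 1) by (unfold n; rewrite (S_INR (S i)); ring).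
    assert (H0 : 0 < INR (S i)) by (apply lt_0_INR; lia).
    rewrite rpow_pos by auto.
    replace (INR (S i)) with (n * (INR (S i) / n)) by (field; lra).
    assert (Hq : 0 < INR (S i) / n) by (apply Rdiv_lt_0_compat; auto).
    rewrite <- Rpower_mult_distr by auto.
    pose proof (Rpower_le_tangent (INR (S i) / n) a Hq ltac:(lra)) as T.
    apply (Rmult_le_compat_l (Rpower n a)) in T; [|lra].
    replace (INR (S i) / n - 1) with (- / n) in T by (rewrite Hn; field; lra).
    lra.
Qed.

(** The displacement allowed after [i] perturbations of norm at most [A]; it is 0 at [i = 0] by the
    convention for [rpow]. *)
Definition growth (q K A : R) (i : nat) : R := K * A * rpow (INR i) (1 / q).

(** If [vnorm v] is at least [A] below the new bound [B], the triangle inequality suffices.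
    Otherwise [vnorm v >= B / 2], and smoothness makes the gain of order [A n^(1/q - 1)] with
    [n = i + 1], like the increment of [growth]. The condition on [K] says exactly that the constant
    of the gain is the smaller one. *)
Lemma weakly_null_step (Y : NormedSpace) (q C K A : R) (U : (nat -> Prop) -> Prop)
    (h : nat -> Y) (v : Y) (i : nat) :
  1 < q -> smooth_with q C Y -> free_ultrafilter U -> wulim U h vzero ->
  0 < A -> (forall n, vnorm (h n) <= A) ->
  2 <= K -> q * C * Rpower 2 (q - 1) < Rpower K q ->
  vnorm v <= growth q K A i -> U (fun n => vnorm (vadd v (h n)) <= growth q K A (S i)).
Proof.
  intros Hq HS HU Hh HA HhA HK HKq Hv.
  assert (HC : 0 < C) by apply HS.
  assert (Hn : 0 < INR (S i)) by (apply lt_0_INR; lia).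
  set (n := INR (S i)) in *.
  assert (Hiq : 0 < 1 / q <= 1).
  { split; [apply Rdiv_lt_0_compat; lra|].
    apply Rmult_le_reg_r with q; [lra|]. unfold Rdiv. rewrite Rmult_1_l, Rinv_l; lra. }
  set (B := growth q K A (S i)) in *.
  assert (HB : B = K * A * Rpower n (1 / q)).
  { unfold B, growth. fold n. rewrite rpow_pos; auto. }
  destruct (Rle_or_lt (vnorm v) (B - A)) as [Hs|Hs].
  { apply (uf_mono U HU _ _ (uf_tail U HU O)). intros m _.
    pose proof (vnorm_triangle Y v (h m)). specialize (HhA m). lra. }
  assert (HKA : 0 < K * A) by (apply Rmult_lt_0_compat; lra).
  assert (Hn1 : 1 <= Rpower n (1 / q)).
  { apply Rle_trans with (Rpower n 0); [rewrite Rpower_O; lra|].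
    apply Rle_Rpower; [|lra].
    unfold n. replace 1 with (INR 1) by reflexivity. apply le_INR. lia. }
  assert (HB2 : 2 * A <= B).
  { rewrite HB. assert (2 * A <= K * A) by (apply Rmult_le_compat_r; lra).
    assert (K * A * 1 <= K * A * Rpower n (1 / q)) by (apply Rmult_le_compat_l; lra). lra. }
  set (r := vnorm v) in *.
  assert (Hr : B / 2 <= r) by lra.
  assert (HrA : A <= r) by lra.
  (* the gain C A (A/r)^(q-1) is at most C A (2A/B)^(q-1), strictly below the increment of [growth] *)
  set (G := C * A * (Rpower (2 / K) (q - 1) * Rpower n (1 / q - 1))).
  assert (HG : r * (C * Rpower (A / r) q) <= G).
  { assert (HAr : 0 < A / r) by (apply Rdiv_lt_0_compat; lra).
    replace q with (q - 1 + 1) by ring. rewrite Rpower_plus, Rpower_1 by auto.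
    replace (r * (C * (Rpower (A / r) (q - 1) * (A / r))))
      with (C * A * Rpower (A / r) (q - 1)) by (field; lra).
    unfold G. apply Rmult_le_compat_l; [left; apply Rmult_lt_0_compat; lra|].
    replace (1 / q - 1) with (- (1 / q) * (q - 1)) by (field; lra).
    replace (q - 1 + 1 - 1) with (q - 1) by ring.
    rewrite <- Rpower_mult, Rpower_mult_distr.
    2: { apply Rdiv_lt_0_compat; lra. }
    2: apply Rpower_pos.
    apply Rle_Rpower_l; [lra|]. split; auto.
    rewrite Rpower_Ropp.
    apply Rle_trans with (A / (B / 2)).
    - unfold Rdiv at 1 2. apply Rmult_le_compat_l; [lra|]. apply Rinv_le_contravar; lra.
    - rewrite HB. right. field. lra. }
  assert (Hinc : r + G < B).
  { pose proof (rpow_INR_increment i (1 / q) Hiq) as T. fold n in T.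
    apply (Rmult_le_compat_l (K * A)) in T; [|lra].
    rewrite <- HB in T. unfold growth in Hv.
    assert (G < K * A * (1 / q * Rpower n (1 / q - 1))); [|lra].
    unfold G. replace (K * A * (1 / q * Rpower n (1 / q - 1)))
      with (A * (K / q * Rpower n (1 / q - 1))) by (field; lra).
    replace (C * A * (Rpower (2 / K) (q - 1) * Rpower n (1 / q - 1)))
      with (A * (C * Rpower (2 / K) (q - 1) * Rpower n (1 / q - 1))) by ring.
    apply Rmult_lt_compat_l; auto. apply Rmult_lt_compat_r; [apply Rpower_pos|].
    unfold Rdiv at 1. rewrite <- Rpower_mult_distr by (try apply Rinv_0_lt_compat; lra).
    replace (Rpower (/ K) (q - 1)) with (K / Rpower K q).
    - pose proof (Rpower_pos K q) as Hp.
      apply Rmult_lt_reg_r with (q * Rpower K q / K).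
      { apply Rdiv_lt_0_compat; [apply Rmult_lt_0_compat|]; lra. }
      replace (C * (Rpower 2 (q - 1) * (K / Rpower K q)) * (q * Rpower K q / K))
        with (q * C * Rpower 2 (q - 1)) by (field; lra).
      replace (K / q * (q * Rpower K q / K)) with (Rpower K q) by (field; lra). auto.
    - rewrite <- (Rpower_1 K) at 1 by lra.
      unfold Rdiv. rewrite <- Rpower_Ropp, <- Rpower_plus.
      unfold Rpower. rewrite ln_Rinv by lra. f_equal. ring. }
  apply (uf_mono U HU _ _
    (* The strict inequality [Hinc] leaves positive room for the error term. *)
    (smooth_weakly_null Y q C A U h v HS HU Hh HA HhA HrA (B - r - G) ltac:(lra))).
  intros m Hm. fold r in Hm. lra.
Qed.

(** * Separated sequences *)

Lemma riesz (V : NormedSpace) (F : V -> Prop) (x : V) :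
  linear_subspace F -> vclosed F -> ~ F x ->
  exists w, vnorm w = 1 /\ forall z, F z -> / 2 <= vnorm (vsub w z).
Proof.
  intros HF HC Hx.
  destruct (closed_gap V F x HF HC Hx) as (d & Hd & Hgap).
  (* The supremum [m] is minus the distance from [x] to [F]. A point [z0] at less than twice that
     distance gives the constant 1/2 after normalising [x - z0]. *)
  destruct (completeness (fun r => exists z, F z /\ r = - vnorm (vsub x z)))
    as [m [Hub Hlub]].
  - exists 0. intros r (z & _ & ->). pose proof (vnorm_ge_0 V (vsub x z)). lra.
  - exists (- vnorm (vsub x vzero)), vzero. split; auto. apply HF.
  - assert (Hm : m <= - d).
    { apply Hlub. intros r (z & Hz & ->).
      assert (Hz' : F (vscal (-1) z)) by (apply HF; auto).
      pose proof (Hgap 1 _ Hz') as H. rewrite Rabs_R1 in H.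
      replace (vadd (vscal (-1) z) (vscal 1 x)) with (vsub x z) in H by vec. lra. }
    assert (Hex : exists z, F z /\ vnorm (vsub x z) < - m * 2).
    { apply NNPP. intros N. assert (m <= m * 2); [|lra].
      apply Hlub. intros r (z & Hz & ->). apply Rnot_lt_le. intros Hlt.
      apply N. exists z. split; auto. lra. }
    destruct Hex as (z0 & Hz0 & Hlt). set (r := vnorm (vsub x z0)) in *.
    assert (Hr : 0 < r).
    { assert (- r <= m) by (apply Hub; exists z0; auto). lra. }
    exists (vscal (/ r) (vsub x z0)). split.
    + rewrite vnorm_scal_pos; [fold r; field; lra|]. left. apply Rinv_0_lt_compat; auto.
    + intros z Hz.
      assert (Hw : F (vadd z0 (vscal r z))) by (apply HF; [|apply HF]; auto).
      assert (H : - vnorm (vsub x (vadd z0 (vscal r z))) <= m) by (apply Hub; eauto).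
      replace (vsub (vscal (/ r) (vsub x z0)) z)
        with (vscal (/ r) (vsub x (vadd z0 (vscal r z)))) by vec.
      rewrite vnorm_scal_pos by (left; apply Rinv_0_lt_compat; auto).
      apply Rmult_le_reg_l with r; auto. rewrite <- Rmult_assoc, Rinv_r by lra. lra.
Qed.

Lemma separated_sequence (V : NormedSpace) : infinite_dimensional V ->
  exists x : nat -> V, (forall n, vnorm (x n) = 1) /\
    forall m n, m <> n -> / 2 <= vnorm (vsub (x m) (x n)).
Proof.
  (* With the zero subspace as base, [add_lines Z l] is the span of [l], a closed proper subspace to
     which [riesz] applies. *)
  intros HV. set (Z := fun x : V => x = vzero).
  assert (HZ : linear_subspace Z).
  { unfold Z. split; [|split]; auto.
    - intros x y -> ->. apply vadd_zero.
    - intros a x ->. apply vscal_0_r. }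
  assert (HZC : vclosed Z).
  { intros x Hx. apply NNPP. intros N. apply vnorm_pos in N.
    destruct (Hx _ N) as (z & -> & H).
    replace (vsub x vzero) with x in H by vec. lra. }
  assert (Hnext : forall l, exists w, vnorm w = 1 /\
      forall z, add_lines Z l z -> / 2 <= vnorm (vsub w z)).
  { intros l. destruct (vsum_of_add_lines V l) as [e He].
    destruct (HV (length l) e) as [x Hx].
    apply (riesz V _ x); auto using add_lines_subspace, add_lines_closed.
    intros Hin. apply Hx. destruct (He Z x Hin) as (c & z & -> & ->).
    exists c. apply vadd_zero. }
  apply choice in Hnext. destruct Hnext as [nxt Hnxt].
  set (st := fix st n := match n with O => [] | S n => nxt (st n) :: st n end).
  exists (fun n => nxt (st n)). split; [intros n; apply Hnxt|].
  assert (Hin : forall m k, In (nxt (st m)) (st (S (k + m)))).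
  { intros m. induction k as [|k IH]; [left; reflexivity|right; exact IH]. }
  assert (Hlt : forall m n, (m < n)%nat -> / 2 <= vnorm (vsub (nxt (st n)) (nxt (st m)))).
  { intros m n Hmn. apply Hnxt. apply add_lines_in; [reflexivity|].
    replace n with (S (n - S m + m))%nat by lia. apply Hin. }
  intros m n Hmn. destruct (Nat.lt_gt_cases m n) as [[H|H] _]; auto.
  rewrite vnorm_sub_sym. auto.
Qed.

(** * Concentration of coarse maps on sums *)

Definition oscillation_le {X Y : NormedSpace} (x : nat -> X) (A : R) (g : X -> Y) : Prop :=
  forall z m n, vnorm (vsub (g (vadd z (x m))) (g (vadd z (x n)))) <= A.

(* The bound on the oscillation in one summand passes to the weak limit over
   another summand, so weak limits can be iterated. *)
Lemma iterated_weak_limits (X Y : NormedSpace) (q C A : R) (U : (nat -> Prop) -> Prop)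
    (x : nat -> X) (f : X -> Y) :
  1 < q -> smooth_with q C Y -> free_ultrafilter U -> reflexive Y -> oscillation_le x A f ->
  exists F : nat -> X -> Y, F O = f /\ (forall j, oscillation_le x A (F j)) /\
    forall j z, wulim U (fun n => F j (vadd z (x n))) (F (S j) z).
Proof.
  intros Hq HS HU HR Hf.
  (* The weak-limit operator, made total by choice; [HT] shows that the chosen value is a weak limit
     for every [g] of bounded oscillation. *)
  set (T := fun (g : X -> Y) z =>
    epsilon (inhabits vzero) (fun y => wulim U (fun n => g (vadd z (x n))) y)).
  assert (HT : forall g, oscillation_le x A g ->
      forall z, wulim U (fun n => g (vadd z (x n))) (T g z)).
  { intros g Hg z. unfold T. apply epsilon_spec.
    apply (wulim_exists Y U _ (A + vnorm (g (vadd z (x O))))); auto.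
    intros n. eapply Rle_trans.
    - apply (vnorm_le_add Y _ (vsub (g (vadd z (x n))) (g (vadd z (x O))))
        (g (vadd z (x O)))). vec.
    - apply Rplus_le_compat_r, Hg. }
  assert (HTo : forall g, oscillation_le x A g -> oscillation_le x A (T g)).
  { intros g Hg z m n.
    apply (wulim_norm_le Y q C A U (fun i => vsub (g (vadd (vadd z (x m)) (x i)))
      (g (vadd (vadd z (x n)) (x i))))); auto.
    - apply (wulim_comb Y U _ _ _ 1 (-1) _ _ _ HU (HT g Hg (vadd z (x m)))
        (HT g Hg (vadd z (x n)))); [intros i; vec|vec].
    (* Commuting the summands turns the exchange of [x m] and [x n] into one for [g] at the base
       point [z + x i]. *)
    - intros i. replace (vadd (vadd z (x m)) (x i)) with (vadd (vadd z (x i)) (x m)) by vec.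
      replace (vadd (vadd z (x n)) (x i)) with (vadd (vadd z (x i)) (x n)) by vec. apply Hg. }
  set (F := fix F j := match j with O => f | S j => T (F j) end).
  assert (HF : forall j, oscillation_le x A (F j)).
  { induction j; simpl; auto. }
  exists F. split; [|split]; auto.
Qed.

(** Replacing the weak limit [h z] by the value [g (z + x n)] adds a weakly null term. Its norm is
    at most [A], being the norm of a weak limit over [m] of [g (z + x n) - g (z + x m)]. *)
Lemma iterated_weak_limits_step (X Y : NormedSpace) (q C K A : R)
    (U : (nat -> Prop) -> Prop) (x : nat -> X) (g h : X -> Y) (z : X) (u : Y) (i : nat) :
  1 < q -> smooth_with q C Y -> free_ultrafilter U -> 0 < A ->
  2 <= K -> q * C * Rpower 2 (q - 1) < Rpower K q ->
  oscillation_le x A g -> wulim U (fun n => g (vadd z (x n))) (h z) ->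
  vnorm (vsub (h z) u) <= growth q K A i ->
  U (fun n => vnorm (vsub (g (vadd z (x n))) u) <= growth q K A (S i)).
Proof.
  intros Hq HS HU HA HK HKq Hg Hh Hv.
  assert (Hnull : wulim U (fun n => vsub (g (vadd z (x n))) (h z)) vzero).
  { apply (wulim_comb Y U _ _ _ 1 (-1) _ _ _ HU Hh (wulim_const Y U (h z) HU));
      [intros n; vec|vec]. }
  assert (HnA : forall n, vnorm (vsub (g (vadd z (x n))) (h z)) <= A).
  { intros n. apply (wulim_norm_le Y q C A U
      (fun m => vsub (g (vadd z (x n))) (g (vadd z (x m))))); auto.
    apply (wulim_comb Y U _ _ _ 1 (-1) _ _ _ HU (wulim_const Y U (g (vadd z (x n))) HU) Hh);
      [intros m; vec|vec]. }
  apply (uf_mono U HU _ _ (weakly_null_step Y q C K A U _ _ i Hq HS HU Hnull HA HnA HK HKq Hv)).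
  intros n Hn. eapply Rle_trans; [|exact Hn]. right. f_equal. vec.
Qed.

Lemma uf_Forall (T : Type) (U : (nat -> Prop) -> Prop) (P : T -> nat -> Prop) (l : list T) :
  free_ultrafilter U -> (forall t, In t l -> U (P t)) ->
  U (fun n => forall t, In t l -> P t n).
Proof.
  intros HU. induction l as [|t l IH]; intros H.
  - apply (uf_mono U HU _ _ (uf_tail U HU O)). intros n _ t [].
  - apply (uf_mono U HU _ _ (uf_and U HU _ _ (H t (or_introl eq_refl))
      (IH (fun s Hs => H s (or_intror Hs))))).
    intros n [H1 H2] s [<-|Hs]; auto.
Qed.

Definition increasing_below (k : nat) (s : nat -> nat) : Prop :=
  forall i, (S i < k)%nat -> (s i < s (S i))%nat.

(* A node [(k, i, z)] records a partial sum [z] of [i] out of [k] terms; all the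
   finitely many nodes reached so far are kept close to [u k] at each choice. *)
Lemma concentrated_subsequence (X Y : NormedSpace) (q C K A : R) (x : nat -> X) (f : X -> Y) :
  1 < q -> smooth_with q C Y -> reflexive Y -> 0 < A ->
  2 <= K -> q * C * Rpower 2 (q - 1) < Rpower K q -> oscillation_le x A f ->
  exists (m : nat -> nat) (u : nat -> Y), strictly_increasing m /\
    forall k s, (k <= s O)%nat -> increasing_below k s ->
      vnorm (vsub (f (vsum (fun i => x (m (s i))) k)) (u k)) <= growth q K A k.
Proof.
  intros Hq HS HR HA HK HKq Hf.
  destruct free_ultrafilter_exists as [U HU].
  destruct (iterated_weak_limits X Y q C A U x f Hq HS HU HR Hf) as (F & HF0 & HFo & HFl).
  set (u := fun k => F k vzero).
  (* After [i] of the [k] choices, [k - i] weak limits remain; at [i = k] the map is [f] itself. The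
     guard [i <= k] is there because subtraction truncates. *)
  set (good := fun t : nat * nat * X => let '(k, i, z) := t in
    (i <= k)%nat -> vnorm (vsub (F (k - i)%nat z) (u k)) <= growth q K A i).
  set (ext := fun n (t : nat * nat * X) => let '(k, i, z) := t in (k, S i, vadd z (x n))).
  assert (Hext : forall t, good t -> U (fun n => good (ext n t))).
  { intros [[k i] z] Hg. simpl in *.
    destruct (Nat.le_gt_cases k i) as [Hki|Hki].
    - apply (uf_mono U HU _ _ (uf_tail U HU O)). intros; lia.
    - assert (Hg' := Hg ltac:(lia)).
      replace (k - i)%nat with (S (k - S i)) in Hg' by lia.
      apply (uf_mono U HU _ _ (iterated_weak_limits_step X Y q C K A U x _ _ z (u k) i
        Hq HS HU HA HK HKq (HFo _) (HFl _ z) Hg')).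
      intros n Hn _. exact Hn. }
  (* Each stage adds the root of a new length, extends every node by the new term, and keeps the old
     nodes for sums that skip it. The root for [k] is present from stage [k] on, whence the
     condition [k <= s O]. *)
  set (next := fun (N n : nat) l => (S N, O, vzero) :: map (ext n) l ++ l).
  assert (Hroot : forall k, good (k, O, vzero)).
  { intros k _. rewrite Nat.sub_0_r. unfold u.
    replace (vsub (F k vzero) (F k vzero)) with (@vzero Y) by vec. rewrite vnorm_0.
    unfold growth. apply Rmult_le_pos; [apply Rmult_le_pos; lra|apply rpow_ge_0]. }
  assert (Hchoose : forall p : nat * list (nat * nat * X), exists n,
      (forall t, In t (snd p) -> good t) ->
      (fst p < n)%nat /\ forall t, In t (map (ext n) (snd p)) -> good t).
  { intros [b l]. simpl.
    destruct (classic (forall t, In t l -> good t)) as [Hl|Hl]; [|exists O; tauto].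
    destruct (uf_ex U HU _ (uf_and U HU _ _ (uf_tail U HU (S b))
      (uf_Forall _ U (fun t n => good (ext n t)) l HU (fun t Ht => Hext t (Hl t Ht)))))
      as (n & Hn & Hn').
    exists n. intros _. split; [lia|]. intros t Ht.
    apply in_map_iff in Ht. destruct Ht as (t' & <- & Ht'). auto. }
  apply choice in Hchoose. destruct Hchoose as [pick Hpick].
  (* The state stores the last chosen index, to make the sequence increase, together with the nodes
     reached so far. *)
  set (st := fix st N := match N with
    | O => (O, [(O, O, @vzero X)])
    | S N => (pick (st N), next N (pick (st N)) (snd (st N)))
    end).
  assert (Hgood : forall N t, In t (snd (st N)) -> good t).
  { induction N as [|N IH]; simpl; intros t Ht.
    - destruct Ht as [<-|[]]. apply Hroot.
    - destruct Ht as [<-|Ht]; [apply Hroot|]. apply in_app_iff in Ht.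
      destruct Ht as [Ht|Ht]; auto. exact (proj2 (Hpick (st N) IH) t Ht). }
  set (m := fun N => pick (st N)).
  assert (Hmono : forall N M t, (N <= M)%nat -> In t (snd (st N)) -> In t (snd (st M))).
  { intros N M t HNM. induction HNM as [|M _ IH]; intros Ht; auto.
    simpl. right. apply in_app_iff. auto. }
  exists m, u. split.
  { intros n. exact (proj1 (Hpick (st (S n)) (Hgood (S n)))). }
  intros k s Hks Hs.
  assert (Hroot_in : In (k, O, vzero) (snd (st k))).
  { destruct k; left; reflexivity. }
  assert (Hin : forall i, (i < k)%nat ->
      In (k, S i, vsum (fun i => x (m (s i))) (S i)) (snd (st (S (s i))))).
  (* A partial sum reached by stage [N] survives until stage [s i], where it is extended by
     [x (m (s i))]. *)
  { assert (Hstep : forall i N, In (k, i, vsum (fun i => x (m (s i))) i) (snd (st N)) ->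
        (N <= s i)%nat ->
        In (k, S i, vsum (fun i => x (m (s i))) (S i)) (snd (st (S (s i))))).
    { intros i N HIn HN. apply (Hmono _ _ _ HN) in HIn. simpl. right.
      apply in_app_iff. left.
      change (In (ext (m (s i)) (k, i, vsum (fun i => x (m (s i))) i))
        (map (ext (m (s i))) (snd (st (s i))))).
      apply in_map, HIn. }
    induction i as [|i IH]; intros Hi.
    - apply (Hstep O k); auto.
    - apply (Hstep (S i) (S (s i))); [apply IH; lia|apply Hs, Hi]. }
  assert (Hk : exists N, In (k, k, vsum (fun i => x (m (s i))) k) (snd (st N))).
  { destruct k as [|k]; [exists O; exact Hroot_in|]. exists (S (s k)). apply Hin. lia. }
  destruct Hk as [N HN]. pose proof (Hgood N _ HN (le_n k)) as H.
  rewrite Nat.sub_diag, HF0 in H. exact H.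
Qed.

(** * Sublinear sums *)

Lemma Rpower_INR_unbounded (a M : R) : 0 < a ->
  exists N, forall k, (N <= k)%nat -> M < Rpower (INR k) a.
Proof.
  intros Ha. set (B := Rmax M 1).
  assert (HB : 0 < B) by (unfold B; pose proof (Rmax_r M 1); lra).
  destruct (INR_unbounded (Rpower B (/ a))) as [N HN].
  exists N. intros k Hk.
  apply le_INR in Hk. apply Rle_lt_trans with B; [apply Rmax_l|].
  pose proof (Rpower_pos B (/ a)).
  rewrite <- (Rpower_1 B HB) at 1. replace 1 with (/ a * a) by (field; lra).
  rewrite <- Rpower_mult. apply Rlt_Rpower_l; auto. lra.
Qed.

Lemma functional_vsum_ge (V : NormedSpace) (phi : V -> R) (g : nat -> V) (c : R) (k : nat) :
  linear_functional phi -> (forall i, c <= phi (g i)) -> INR k * c <= phi (vsum g k).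
Proof.
  intros [Ha Hs] Hc. induction k as [|k IH].
  - simpl. rewrite <- (vscal_0_l V vzero), Hs. lra.
  - rewrite S_INR. simpl vsum. rewrite Ha. specialize (Hc k). lra.
Qed.

(** If [phi (y n) >= eps] for infinitely many [n], then [phi] is at least [k * eps] on suitable sums
    of [k] late terms, whose norms are only [O(k^b)]. Applying this to [phi] and [- phi] gives weak
    nullity. *)
Lemma sublinear_sums_weakly_null (V : NormedSpace) (y : nat -> V) (D b : R) :
  b < 1 ->
  (forall k s, (1 <= k)%nat -> (k <= s O)%nat -> increasing_below k s ->
     vnorm (vsum (fun i => y (s i)) k) <= D * Rpower (INR k) b) ->
  weakly_null y.
Proof.
  intros Hb Hy.
  assert (Key : forall phi eps, bounded_linear phi -> 0 < eps ->
      exists N, forall n, (N <= n)%nat -> phi (y n) < eps).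
  { intros phi eps [Hlin [M [HM Hbd]]] Heps. apply NNPP. intros Hn.
    assert (Hex : forall N, exists n, (N <= n)%nat /\ eps <= phi (y n)).
    { intros N. apply NNPP. intros H. apply Hn. exists N. intros n HNn.
      apply Rnot_le_lt. intros Hle. apply H. eauto. }
    apply choice in Hex. destruct Hex as [nxt Hnxt].
    (* [k] is chosen so large that [M D k^b < k eps]. *)
    destruct (Rpower_INR_unbounded (1 - b) (M * D / eps)) as [N HN]; [lra|].
    set (k := S N). specialize (HN k ltac:(unfold k; lia)).
    set (s := fix s i := match i with O => nxt k | S i => nxt (S (s i)) end).
    assert (Hk0 : 0 < INR k) by (apply lt_0_INR; unfold k; lia).
    assert (H1 : vnorm (vsum (fun i => y (s i)) k) <= D * Rpower (INR k) b).
    { apply Hy; [unfold k; lia|apply Hnxt|]. intros i _. apply (Hnxt (S (s i))). }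
    assert (H2 : INR k * eps <= phi (vsum (fun i => y (s i)) k)).
    { apply functional_vsum_ge; auto. intros [|i]; apply Hnxt. }
    pose proof (Hbd (vsum (fun i => y (s i)) k)) as H3.
    pose proof (Rle_abs (phi (vsum (fun i => y (s i)) k))).
    assert (H4 : M * vnorm (vsum (fun i => y (s i)) k) <= M * (D * Rpower (INR k) b))
      by (apply Rmult_le_compat_l; auto).
    pose proof (Rpower_pos (INR k) b) as Hp.
    apply (Rmult_lt_compat_r (eps * Rpower (INR k) b)) in HN;
      [|apply Rmult_lt_0_compat; auto].
    replace (Rpower (INR k) (1 - b) * (eps * Rpower (INR k) b)) with (INR k * eps) in HN.
    - replace (M * D / eps * (eps * Rpower (INR k) b)) with (M * (D * Rpower (INR k) b))
        in HN by (field; lra). lra.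
    - rewrite <- (Rpower_1 (INR k)) at 1 by auto.
      replace 1 with (1 - b + b) at 1 by ring. rewrite Rpower_plus. ring. }
  intros phi Hphi eps Heps.
  destruct (Key phi eps Hphi Heps) as [N HN].
  assert (Hneg : bounded_linear (fun v => - phi v)).
  { destruct Hphi as [[Ha Hs] [M [HM Hbd]]]. split; [split|].
    - intros v w. rewrite Ha. ring.
    - intros a v. rewrite Hs. ring.
    - exists M. split; auto. intros v. rewrite Rabs_Ropp. auto. }
  destruct (Key _ eps Hneg Heps) as [N' HN'].
  exists (N + N')%nat. intros n Hn. unfold Rdist. rewrite Rminus_0_r.
  specialize (HN n ltac:(lia)). specialize (HN' n ltac:(lia)). simpl in HN'.
  apply Rabs_def1; lra.
Qed.

(** If [b < 1/p], the upper bound first makes [y] weakly null, so the co-Banach-Saks property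
    applies, and then contradicts its lower bound on the same sums. *)
Lemma co_Banach_Saks_exponent (X : NormedSpace) (p D b a : R) (y : nat -> X) :
  1 < p -> almost_p_co_Banach_Saks p X -> 0 < a ->
  (forall n, a <= vnorm (y n) <= 2) ->
  (forall k s, (1 <= k)%nat -> (k <= s O)%nat -> increasing_below k s ->
     vnorm (vsum (fun i => y (s i)) k) <= D * Rpower (INR k) b) ->
  1 / p <= b.
Proof.
  intros Hp HX Ha Hy Hs. apply Rnot_lt_le. intros Hb.
  assert (H1p : 1 / p < 1).
  { apply Rmult_lt_reg_r with p; [lra|]. unfold Rdiv. rewrite Rmult_assoc, Rinv_l; lra. }
  assert (Hnull : weakly_null y) by (apply (sublinear_sums_weakly_null X y D b); auto; lra).
  destruct (HX y) as (phi & theta & Hphi & Hth & Hlim & Hlow); auto.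
  { exists a, 2. split; [|split]; auto. pose proof (Hy O). lra. }
  (* [theta] grows more slowly than the positive power [1/p - b], so eventually
     [k^(1/p) / theta k > D k^b]. *)
  destruct (Hlim (1 / p - b) ltac:(lra) D) as [N HN].
  set (k := S N). specialize (HN k ltac:(unfold k; lia)).
  assert (Hphi_ge : forall n, (n <= phi n)%nat).
  { induction n as [|n IH]; [lia|]. specialize (Hphi n). lia. }
  assert (Hphi_lt : forall m n, (m < n)%nat -> (phi m < phi n)%nat).
  { intros m n Hmn. induction Hmn as [|n _ IH]; [apply Hphi|]. specialize (Hphi n). lia. }
  (* Both bounds are taken for the block of indices [k, ..., 2k - 1] of the subsequence;
     [phi n >= n] keeps its terms late in [y]. *)
  assert (L := Hlow k (fun i => (k + i)%nat) ltac:(unfold k; lia)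
    ltac:(intros; cbv beta; lia) ltac:(cbv beta; lia)).
  assert (T := Hs k (fun i => phi (k + i)%nat) ltac:(unfold k; lia)
    ltac:(cbv beta; rewrite Nat.add_0_r; apply Hphi_ge)
    ltac:(intros i _; apply Hphi_lt; lia)).
  assert (Hk0 : 0 < INR k) by (apply lt_0_INR; unfold k; lia).
  rewrite rpow_pos in HN, L by auto.
  pose proof (Rpower_pos (INR k) b) as Hpb.
  apply (Rmult_lt_compat_r _ _ _ Hpb) in HN.
  assert (Ht : 0 < theta k) by (specialize (Hth k); lra).
  replace (Rpower (INR k) (1 / p - b) / theta k * Rpower (INR k) b)
    with (Rpower (INR k) (1 / p) / theta k) in HN; [lra|].
  replace (1 / p) with (1 / p - b + b) at 1 by ring. rewrite Rpower_plus. field. lra.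
Qed.

(** * Bounding the compression exponent *)

Lemma Rpower_growth_constant (q C : R) : 1 < q -> 0 < C ->
  exists K, 2 <= K /\ q * C * Rpower 2 (q - 1) < Rpower K q.
Proof.
  intros Hq HC.
  destruct (Rpower_INR_unbounded q (q * C * Rpower 2 (q - 1))) as [N HN]; [lra|].
  exists (INR (N + 2)). split; [|apply HN; lia].
  replace 2 with (INR 2) by (simpl; lra). apply le_INR. lia.
Qed.

(* If the images of two sums of k terms are within O(k^(1/q)), compression of
   exponent [alpha] forces the sums themselves to be within O(k^(1/(q alpha))). *)
Lemma compression_sum_bound (alpha L B q S k : R) :
  0 < alpha -> 0 < L -> 0 <= B -> 1 < q -> 1 <= k -> 0 <= S ->
  / L * rpow S alpha - L <= B * Rpower k (1 / q) ->
  S <= Rpower (L * (B + L)) (/ alpha) * Rpower k (/ (q * alpha)).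
Proof.
  intros Ha HL HB Hq Hk HS H.
  pose proof (Rpower_pos (L * (B + L)) (/ alpha)) as P1.
  pose proof (Rpower_pos k (/ (q * alpha))) as P2.
  destruct HS as [HS|<-]; [|left; apply Rmult_lt_0_compat; auto].
  rewrite rpow_pos in H by auto.
  assert (Hk1 : 1 <= Rpower k (1 / q)).
  { apply Rle_trans with (Rpower k 0); [rewrite Rpower_O; lra|].
    apply Rle_Rpower; auto. left. apply Rdiv_lt_0_compat; lra. }
  assert (HD : 0 < L * (B + L)) by (apply Rmult_lt_0_compat; lra).
  assert (H1 : Rpower S alpha <= L * (B + L) * Rpower k (1 / q)).
  (* The additive constant [L] is absorbed using [k^(1/q) >= 1]. *)
  { assert (T : / L * Rpower S alpha <= (B + L) * Rpower k (1 / q)).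
    { assert (L * 1 <= L * Rpower k (1 / q)) by (apply Rmult_le_compat_l; lra). lra. }
    apply (Rmult_le_compat_l L) in T; [|lra].
    replace (L * (/ L * Rpower S alpha)) with (Rpower S alpha) in T by (field; lra).
    lra. }
  assert (Hia : 0 < / alpha) by (apply Rinv_0_lt_compat; auto).
  apply (fun T => Rle_Rpower_l _ _ (/ alpha) (Rlt_le _ _ Hia) (conj (Rpower_pos S alpha) T)) in H1.
  rewrite <- Rpower_mult_distr, !Rpower_mult in H1; [|auto|apply Rpower_pos].
  replace (alpha * / alpha) with 1 in H1 by (field; lra). rewrite Rpower_1 in H1 by auto.
  replace (1 / q * / alpha) with (/ (q * alpha)) in H1 by (field; lra). exact H1.
Qed.

Lemma compression_exponent_le (p q : R) (X Y : NormedSpace) :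
  1 < p -> p < q -> infinite_dimensional X -> almost_p_co_Banach_Saks p X ->
  reflexive Y -> asymptotically_uniformly_smooth q Y -> compression_le X Y (p / q).
Proof.
  intros Hp Hpq HXi HXp HYr HYs alpha Ha f L [Hf _] HL Hlow.
  assert (Hq : 1 < q) by lra.
  destruct (smooth_with_exists q Y HYs) as [C HS].
  destruct (Rpower_growth_constant q C Hq (proj1 HS)) as (K & HK & HKq).
  destruct (separated_sequence X HXi) as (x & Hx1 & Hx2).
  assert (Hx3 : forall m n, vnorm (vsub (x m) (x n)) <= 2).
  { intros m n. pose proof (vnorm_le_add X (vsub (x m) (x n)) (x m) (vopp (x n))
      ltac:(vec)) as T. rewrite vnorm_opp, !Hx1 in T. lra. }
  destruct (Hf 2) as [M HM].
  (* Terms of [x] differ by at most 2, so the bound [M] at distance 2 controls the oscillation; the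
     maximum with 1 makes it positive. *)
  set (A := Rmax M 1). assert (HA : 0 < A) by (pose proof (Rmax_r M 1); unfold A; lra).
  assert (Hosc : oscillation_le x A f).
  { intros z m n. apply Rle_trans with M; [|apply Rmax_l]. apply HM. unfold dist.
    replace (vsub (vadd z (x m)) (vadd z (x n))) with (vsub (x m) (x n)) by vec.
    apply Hx3. }
  destruct (concentrated_subsequence X Y q C K A x f Hq HS HYr HA HK HKq Hosc)
    as (m & u & Hm & Hu).
  (* A sum of [k] late terms of [y] is a difference of two sums of [k] late terms of [x] along [m].
     Their images lie in one ball around [u k], hence the factor 2 in the constant below. *)
  set (y := fun n => vsub (x (m (2 * n)%nat)) (x (m (2 * n + 1)%nat))).
  assert (Hsum : forall k s, (1 <= k)%nat -> (k <= s O)%nat -> increasing_below k s ->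
      vnorm (vsum (fun i => y (s i)) k) <=
      Rpower (L * (2 * (K * A) + L)) (/ alpha) * Rpower (INR k) (/ (q * alpha))).
  { intros k s Hk Hks Hs.
    assert (HKA : 0 < K * A) by (apply Rmult_lt_0_compat; lra).
    assert (Hk1 : 1 <= INR k) by (replace 1 with (INR 1) by reflexivity; apply le_INR; auto).
    assert (B1 := Hu k (fun i => (2 * s i)%nat) ltac:(cbv beta; lia)
      ltac:(intros i Hi; specialize (Hs i Hi); cbv beta; lia)).
    assert (B2 := Hu k (fun i => (2 * s i + 1)%nat) ltac:(cbv beta; lia)
      ltac:(intros i Hi; specialize (Hs i Hi); cbv beta; lia)).
    unfold y. rewrite vsum_sub.
    set (v := vsum (fun i => x (m (2 * s i)%nat)) k) in *.
    set (w := vsum (fun i => x (m (2 * s i + 1)%nat)) k) in *.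
    apply compression_sum_bound; auto using vnorm_ge_0; [lra|].
    unfold growth in B1, B2. rewrite rpow_pos in B1, B2 by lra.
    specialize (Hlow v w). unfold dist in Hlow.
    pose proof (vnorm_le_add Y (vsub (f v) (f w)) (vsub (f v) (u k)) (vsub (u k) (f w))
      ltac:(vec)) as T.
    rewrite (vnorm_sub_sym Y (u k)) in T. lra. }
  assert (Hy : forall n, / 2 <= vnorm (y n) <= 2).
  { intros n. split; [|apply Hx3]. apply Hx2.
    replace (2 * n + 1)%nat with (S (2 * n)) by lia. pose proof (Hm (2 * n)%nat). lia. }
  assert (H := co_Banach_Saks_exponent X p _ _ (/ 2) y Hp HXp ltac:(lra) Hy Hsum).
  (* It remains to rearrange [1/p <= 1/(q alpha)] into [alpha <= p/q]. *)
  apply Rmult_le_reg_r with (q / p); [apply Rdiv_lt_0_compat; lra|].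
  replace (p / q * (q / p)) with 1 by (field; lra).
  apply (Rmult_le_compat_r (q * alpha)) in H; [|left; apply Rmult_lt_0_compat; lra].
  rewrite Rinv_l in H by (apply Rgt_not_eq, Rmult_lt_0_compat; lra).
  unfold Rdiv in *. lra.
Qed.

Theorem theorem4p5 (p q : R) (X Y : NormedSpace) :
  1 < p -> p < q ->
  complete X -> infinite_dimensional X -> almost_p_co_Banach_Saks p X ->
  complete Y -> reflexive Y -> asymptotically_uniformly_smooth q Y ->
  compression_le X Y (p / q) /\
  ~ (exists (f : X -> Y) (L : R), coarse_Lipschitz_embedding f L).
Proof.
  intros Hp Hpq _ HXi HXp _ HYr HYs.
  assert (HC : compression_le X Y (p / q)) by (apply compression_exponent_le; auto).
  split; auto. intros (f & L & HL & Hup & Hlow).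
  assert (H : 1 <= p / q).
  { apply (HC 1 Rlt_0_1 f L); auto.
    - split.
      (* The Lipschitz bound is available for [t >= 0] only, while [t] is arbitrary here. *)
      + intros t. exists (L * Rmax t 0 + L). intros x y Hxy.
        apply Hup; [apply Rmax_r|]. apply Rle_trans with t; [auto|apply Rmax_l].
      (* [L * (M + L)] solves [t / L - L = M]. *)
      + intros M. exists (Rmax 0 (L * (M + L))). intros t Ht x y Hxy.
        pose proof (Rmax_l 0 (L * (M + L))). pose proof (Rmax_r 0 (L * (M + L))).
        pose proof (Hlow t x y ltac:(lra) Hxy) as H1.
        assert (H2 : / L * (L * (M + L)) <= / L * t).
        { apply Rmult_le_compat_l; [left; apply Rinv_0_lt_compat; auto|lra]. }
        rewrite <- Rmult_assoc, Rinv_l in H2 by lra. lra.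
    - intros x y. replace (rpow (dist x y) 1) with (dist x y).
      + apply Hlow; [apply vnorm_ge_0|lra].
      + unfold rpow. pose proof (vnorm_ge_0 X (vsub x y)). fold (dist x y) in *.
        destruct (Rle_dec (dist x y) 0); [lra|]. rewrite Rpower_1; lra. }
  assert (p / q < 1); [|lra].
  apply Rmult_lt_reg_r with q; [lra|]. unfold Rdiv. rewrite Rmult_assoc, Rinv_l; lra.
Qed.
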